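(* Consider the join-the-shortest-queue (JSQ) system with $n$ servers, service rate $\mu>0$ per server and arrival rate $\lambda_n$, and let $\mathbf q=(q_1,\dots,q_n)$ be its steady-state queue length vector. Suppose the system satisfies $\lambda_n=n\mu(1-n^{-\alpha})$, i.e. $\epsilon_n=n^{-\alpha}$, where $\alpha>1$. Then for any $\theta<1$, $$\lim_{n\to\infty}\mathbb E\Big[e^{\theta n^{-\alpha}\sum_{i=1}^n q_i}\Big]=\frac1{1-\theta},$$ and $$n^{1-\alpha}\,\mathbf q\ \xrightarrow{d}\ \Upsilon\,\mathbf 1\qquad\text{as } n\to\infty,$$ where $\Upsilon$ is an exponential random variable with mean $1$ and $\mathbf 1$ is the vector of all ones.
   Context: JSQ system: a continuous-time system of $n$ single-server first-come-first-served queues in parallel. Jobs arrive according to a Poisson process of rate $\lambda_n$, and service times are exponentially distributed with rate $\mu$ at each server. $q_i(t)$ is the length of queue $i$ at time $t$. Each arriving job is sent to a queue in $\arg\min_i q_i(t)$, ties being broken uniformly at random. The process $\mathbf q(t)=(q_1(t),\dots,q_n(t))$ is a continuous-time Markov chain, positive recurrent when $\lambda_n<n\mu$. Its stationary distribution is $\pi_n$, and $\mathbf q$ denotes a random vector with law $\pi_n$. The parameter $\epsilon_n$ is defined by $\epsilon_n=1-\frac{\lambda_n}{n\mu}$. The symbol $\xrightarrow{d}$ denotes convergence in distribution. *)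

(* Defs.v *)
From HB Require Import structures.
From mathcomp Require Import all_boot all_order all_algebra.
From mathcomp Require Import all_classical all_reals all_analysis.

Set Implicit Arguments.
Unset Strict Implicit.
Unset Printing Implicit Defensive.

Import Order.TTheory GRing.Theory Num.Theory.
Import numFieldNormedType.Exports.

Local Open Scope classical_set_scope.
Local Open Scope ring_scope.

Definition jsq_state (n : nat) := {ffun 'I_n -> nat}.

Definition add_job n (x : jsq_state n) (i : 'I_n) : jsq_state n :=
  [ffun j => (x j + (j == i))%N].

Definition remove_job n (x : jsq_state n) (i : 'I_n) : jsq_state n :=
  [ffun j => (x j - (j == i))%N].

Definition shortest_queues n (x : jsq_state n) : {set 'I_n} :=
  [set i | [forall j, (x i <= x j)%N]].

(* The queue-length process of JSQ with ties broken uniformly: an arrival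
   (rate lambda) joins each of the shortest queues with equal probability, and
   every nonempty queue completes service at rate mu. *)
Definition jsq_rate (R : realType) n (lambda mu : R) (x y : jsq_state n) : R :=
  \sum_(i in shortest_queues x)
     lambda / #|shortest_queues x|%:R * (y == add_job x i)%:R
  + \sum_(i | (0 < x i)%N) mu * (y == remove_job x i)%:R.

(* jsq_rate x x = 0, so the first summand only contributes off the diagonal;
   for n > 0 the total exit rate is lambda + mu * (number of busy servers). *)
Definition jsq_generator (R : realType) n (lambda mu : R)
    (x y : jsq_state n) : R :=
  jsq_rate lambda mu x y
  - (x == y)%:R * (lambda + mu * #|[set i | (0 < x i)%N]|%:R).

(* P t x y is the probability that a continuous-time Markov chain with
   Q-matrix Q, started from x, is in state y at time t. *)
Record ctmc_transition (R : realType) (S : choiceType) (Q : S -> S -> R)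
    (P : R -> S -> S -> R) : Prop := {
  ctmc_ge0 : forall t x y, 0 <= t -> 0 <= P t x y ;
  ctmc_sum1 : forall t x, 0 <= t ->
    (\esum_(y in [set: S]) (P t x y)%:E = 1)%E ;
  ctmc_at0 : forall x y, P 0 x y = (x == y)%:R ;
  ctmc_chapman_kolmogorov : forall s t x y, 0 <= s -> 0 <= t ->
    (\esum_(z in [set: S]) (P s x z * P t z y)%:E = (P (s + t) x y)%:E)%E ;
  ctmc_infinitesimal : forall x y,
    (P h x y - (x == y)%:R) / h @[h --> 0^'+] --> Q x y
}.

Definition stationary_distribution (R : realType) (S : choiceType)
    (P : R -> S -> S -> R) (pi : S -> \bar R) : Prop :=
  [/\ (forall x, (0 <= pi x)%E),
      (\esum_(x in [set: S]) pi x = 1)%E &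
      forall t y, 0 <= t ->
        (\esum_(x in [set: S]) (pi x * (P t x y)%:E) = pi y)%E].

(* Joint law of n integer-valued random variables, as a mass function. *)
Definition joint_law (R : realType) (d : measure_display) (T : measurableType d)
    (P : probability T R) n (q : 'I_n -> {RV P >-> nat}) (x : jsq_state n)
    : \bar R :=
  P [set w | forall i, q i w = x i].

(* Weak convergence of the laws, tested against bounded continuous functions;
   each X n may live on its own probability space. *)
Definition cvg_in_distribution (R : realType) (S : topologicalType)
    (d : nat -> measure_display) (T : forall n, measurableType (d n))
    (P : forall n, probability (T n) R) (X : forall n, T n -> S)
    (d' : measure_display) (T' : measurableType d') (P' : probability T' R)
    (Y : T' -> S) : Prop :=
  forall f : S -> R, continuous f -> (exists M, forall s, `|f s| <= M) ->
    ('E_(P n)[f \o X n] @[n --> \oo] --> 'E_P'[f \o Y])%E.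

(* Vectors of varying finite dimension are regarded as elements of the space of
   real sequences with its product topology, padding with zeros. *)
Definition pad (R : realType) n (v : 'I_n -> R) : {ptws nat -> R} :=
  fun i => if insub i is Some j then v j else 0.

(* Main.v *)
(* Let S be the total number of jobs, I the number of idle servers, qbar = S / n,
   m the shortest queue, Y = qbar - m, eps = n^-alpha.

   Zero mean drift of exp(theta eps S) reads
     n (1 - (1 - eps) e^(theta eps)) E[e^(theta eps S)] = E[I e^(theta eps S)],
   where the left coefficient is n eps (1 - theta + o(1)), and E[I] = n eps.
   A server idles only if m = 0, and then S = n Y. Hence if Y has a bounded
   exponential moment, e^(theta eps S) is 1 + o(1) on {I > 0}, up to an event that
   is negligible against n eps = n^(1 - alpha), because alpha > 1. This gives the
   limit 1 / (1 - theta).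

   The moment of Y comes from the drift of sum_j e^(c (q_j - qbar)). For c > 0 a
   long queue drains relative to qbar while arrivals only join queues below it,
   so this sum has mean O(n). For c = -1 the arrivals, all joining the shortest
   queue, contribute about - n e^Y, while the sum itself is a small multiple of
   n e^Y unless the positive excesses are large, which the case c > 0 controls.

   The same bounds concentrate n^(1 - alpha) q_i around eps S for all i at once;
   and eps S converges in law because its Laplace transform at the integers is
   the moment sequence of e^(- eps S) in [0, 1] (Weierstrass approximation). *)

Require Import Defs.
From HB Require Import structures.
From mathcomp Require Import all_boot all_order all_algebra.
From mathcomp Require Import all_classical all_reals all_analysis.
From mathcomp Require Import finmap measurable_realfun lra ring.
Import Order.TTheory GRing.Theory Num.Theory.
Import numFieldNormedType.Exports.
Local Open Scope classical_set_scope.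
Local Open Scope ring_scope.

Set Implicit Arguments.
Unset Strict Implicit.
Unset Printing Implicit Defensive.

(** * Stationary distributions of chains with bounded rates *)

(** Stationarity is given as invariance under [Pt], whose derivative at 0 is known only entry by
    entry, and no moment of the queue lengths is known to be finite. So balance equations come
    first, and exponential moments are obtained from one-sided drift inequalities, where truncation
    replaces integrability; exact zero-drift identities are used only for [total] and its
    exponential, once these are integrable. The exponent c > 0 is 160 throughout. For c = -1 and in
    units of mu, the unfavourable terms cost at most 5 times the exponential deficits, against a
    gain n e^Y / 4. If the average positive excess A is at most Y / 160, the deficits average at
    most 20 + e^Y / 40, and 5 / 40 is half of 1 / 4; otherwise e^Y is below e^(160 A), and the
    moment for c = 160 takes over. Test functions for convergence in law are continuous on a space
    of infinitely many coordinates, with no modulus of continuity given; compactness of [0, K]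
    supplies one near the diagonal. *)

Lemma esum_exchange (R : realType) (T1 T2 : choiceType) (a : T1 -> T2 -> \bar R) :
  (forall i j, 0 <= a i j)%E ->
  (\esum_(i in [set: T1]) \esum_(j in [set: T2]) a i j =
   \esum_(j in [set: T2]) \esum_(i in [set: T1]) a i j)%E.
Proof.
move=> a0; rewrite !esum_esum//.
rewrite (reindex_esum ([set: T2] `*`` (fun=> [set: T1])) _
  (fun x => (x.2, x.1)))//; split=> //=.
- by move=> [i1 j1] [i2 j2] /= _ _ [-> ->].
- by move=> [i j] _; exists (j, i).
Qed.

Lemma ge0_esumZl (R : realType) (T : choiceType) (c : R) (a : T -> \bar R) : 0 <= c ->
  (forall i, 0 <= a i)%E ->
  (\esum_(i in [set: T]) (c%:E * a i) = c%:E * \esum_(i in [set: T]) a i)%E.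
Proof.
(* One inequality suffices: applied to [c^-1] and the family [c%:E * a i], it yields the reverse
   one. *)
move=> c0 a0; have H (b : T -> \bar R) (k : R) : 0 <= k -> (forall i, 0 <= b i)%E ->
    (\esum_(i in [set: T]) (k%:E * b i) <= k%:E * \esum_(i in [set: T]) b i)%E.
  move=> k0 b0; apply: ge_ereal_sup => _ [X [finX _] <-].
  rewrite -ge0_mule_fsumr//; apply: lee_wpmul2l; first by rewrite lee_fin.
  by apply: esum_ge; exists X.
apply/eqP; rewrite eq_le H//=.
have [->|c_neq0] := eqVneq c 0.
  by rewrite mul0e esum_ge0// => i _; rewrite mul0e.
have {c_neq0}c0 : 0 < c by rewrite lt0r c_neq0.
rewrite -lee_pdivlMl//; apply: le_trans (H _ _ _ _).
- by apply: le_esum => i _; rewrite muleA -EFinM mulVf ?gt_eqF// mul1e.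
- by rewrite invr_ge0 ltW.
- by move=> i; rewrite mule_ge0// lee_fin ltW.
Qed.

Section stationary_balance.
Context (R : realType) (S : choiceType).
Variables (r : S -> S -> R) (e : S -> R) (C : R).
Hypothesis r_ge0 : forall x y, 0 <= r x y.
Hypothesis r_sum : forall x, (\esum_(y in [set: S]) (r x y)%:E = (e x)%:E)%E.
Hypothesis e_le : forall x, e x <= C.
Variables (Pt : R -> S -> S -> R) (pi : S -> \bar R).
Hypothesis Pt_ctmc :
  ctmc_transition (fun x y => r x y - (x == y)%:R * e x) Pt.
Hypothesis pi_stat : stationary_distribution Pt pi.

Lemma exit_rate_ge0 x : 0 <= e x.
Proof. by rewrite -lee_fin -r_sum esum_ge0// => y _; rewrite lee_fin. Qed.

Lemma stationary_fin_num x : pi x \is a fin_num.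
Proof.
have [pi0 pi1 _] := pi_stat.
rewrite ge0_fin_numE//; apply: (@le_lt_trans _ _ 1%E); last exact: ltry.
rewrite -pi1 -(esum_set1 (pi0 x)) [leLHS]esum_mkcond; apply: le_esum => y _.
by case: ifP.
Qed.

(* Fatou for h -> 0+ over finite sets of source states only gives an inequality. *)
Lemma stationary_inflow_le y :
  (\esum_(x in [set: S]) (pi x * (r x y)%:E) <= pi y * (e y)%:E)%E.
Proof.
have [pi0 pi1 piP] := pi_stat; have [P0 P1 _ _ Pd] := Pt_ctmc.
pose p x := fine (pi x).
have pE x : pi x = (p x)%:E by rewrite fineK// stationary_fin_num.
have p0 x : 0 <= p x by rewrite -lee_fin -pE.
apply: ge_ereal_sup => _ [X [finX _] <-].
rewrite fsbig_finite//=.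
(* Adjoining [y] brings the diagonal entry of the Q-matrix into the finite sum; it carries the
   outflow [p y * e y]. *)
pose F := (y |` fset_set X)%fset.
have lim_le : \sum_(x <- F) p x * (r x y - (x == y)%:R * e x) <= 0.
  have lim_h : \sum_(x <- F) p x * ((Pt h x y - (x == y)%:R) / h) @[h --> 0^'+]
      --> \sum_(x <- F) p x * (r x y - (x == y)%:R * e x).
    apply: cvg_big => [|x _]; first exact: add_continuous.
    by apply: cvgM; [exact: cvg_cst|exact: Pd].
  apply: (cvgr_to_le lim_h).
  near=> h.
  have h0 : 0 < h by near: h; exact: nbhs_right_gt.
  under eq_bigr do rewrite mulrA.
  rewrite -mulr_suml; apply: mulr_le0_ge0; last by rewrite invr_ge0 ltW.
  under eq_bigr do rewrite mulrBr.
  rewrite sumrB subr_le0.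
  have -> : \sum_(x <- F) p x * (x == y)%:R = p y.
    rewrite (big_fsetD1 y)/=; last by rewrite fset1U1.
    rewrite eqxx mulr1 big1_fset ?addr0// => x.
    by rewrite in_fsetD1 => /andP[/negPf-> _] _; rewrite mulr0.
  (* Invariance at time [h]: a finite part of the sum that equals [pi y] cannot exceed it. *)
  rewrite -lee_fin -pE -(piP h y (ltW h0)) -sumEFin.
  apply: esum_ge; exists [set` F] => //.
  rewrite fsbig_finite//= set_fsetK; apply: lee_sum => x _.
  by rewrite pE EFinM.
rewrite [leLHS](_ : _ = (\sum_(x <- fset_set X) p x * r x y)%:E); last first.
  by rewrite -sumEFin; apply: eq_bigr => x _; rewrite pE EFinM.
rewrite pE -EFinM lee_fin.
apply: (@le_trans _ _ (\sum_(x <- F) p x * r x y)).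
  rewrite /F; have [yX|yX] := boolP (y \in fset_set X).
    by rewrite (_ : (y |` _)%fset = fset_set X)//; apply/fsetUidPr; rewrite fsub1set.
  by rewrite big_fsetU1//= lerDr mulr_ge0.
have := lim_le; under eq_bigr do rewrite mulrBr.
rewrite sumrB subr_le0 => /le_trans; apply.
rewrite (big_fsetD1 y)/=; last by rewrite fset1U1.
rewrite eqxx mul1r big1_fset ?addr0// => x.
by rewrite in_fsetD1 => /andP[/negPf-> _] _; rewrite mul0r mulr0.
Unshelve. all: by end_near. Qed.

(* Summed over all states, inflow and outflow agree and are finite because the
   exit rates are bounded; hence no inequality above can be strict. *)
Lemma stationary_balance y :
  (\esum_(x in [set: S]) (pi x * (r x y)%:E) = pi y * (e y)%:E)%E.
Proof.
have [pi0 pi1 piP] := pi_stat.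
have e0 := exit_rate_ge0.
pose inf x := (\esum_(z in [set: S]) (pi z * (r z x)%:E))%E.
pose out x := (pi x * (e x)%:E)%E.
have in0 x : (0 <= inf x)%E.
  by apply: esum_ge0 => z _; rewrite mule_ge0// lee_fin.
have out0 x : (0 <= out x)%E by rewrite mule_ge0// lee_fin.
have total : (\esum_(x in [set: S]) inf x = \esum_(x in [set: S]) out x)%E.
  rewrite /inf esum_exchange; last by move=> i j; rewrite mule_ge0// lee_fin.
  apply: eq_esum => x _; rewrite /out -r_sum.
  rewrite -(fineK (stationary_fin_num x)) ge0_esumZl//.
  - by rewrite fine_ge0.
  - by move=> z; rewrite lee_fin.
have total_fin : (\esum_(x in [set: S]) out x < +oo)%E.
  apply: (@le_lt_trans _ _ (C%:E * \esum_(x in [set: S]) pi x)%E).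
    rewrite -ge0_esumZl//; last exact: le_trans (e0 y) (e_le y).
    apply: le_esum => x _; rewrite /out muleC lee_wpmul2r// lee_fin.
    exact: e_le.
  by rewrite pi1 mule1 ltry.
have split1 (f : S -> \bar R) : (forall x, 0 <= f x)%E -> (\esum_(x in [set: S]) f x =
    f y + \esum_(x in ~` [set y]) f x)%E.
  move=> f0; rewrite (esumID [set y] [set: S] f)// !setTI esum_set1//.
apply/eqP; rewrite eq_le stationary_inflow_le/= -/(inf y) -/(out y).
move: total total_fin; rewrite !split1// => total total_fin.
have restE : (\esum_(x in ~` [set y]) inf x <= \esum_(x in ~` [set y]) out x)%E.
  by apply: le_esum => x _; exact: stationary_inflow_le.
have rest0 : (0 <= \esum_(x in ~` [set y]) inf x)%E by exact: esum_ge0.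
have rest_fin : (\esum_(x in ~` [set y]) inf x)%E \is a fin_num.
  rewrite ge0_fin_numE//; apply: le_lt_trans restE _.
  by apply: le_lt_trans total_fin; rewrite leeDr.
have : (out y + \esum_(x in ~` [set y]) inf x <=
    inf y + \esum_(x in ~` [set y]) inf x)%E.
  by rewrite total leeD2l.
by rewrite leeD2rE.
Qed.

(** The balance equation at [y] is weighted by [f y] and summed over [y]. Nonnegativity alone
    permits the exchange of sums, so both sides may be infinite. *)
Lemma stationary_flow (f : S -> R) : (forall x, 0 <= f x) ->
  (\esum_(x in [set: S]) (pi x * \esum_(y in [set: S]) (r x y * f y)%:E) =
   \esum_(x in [set: S]) (pi x * (e x * f x)%:E))%E.
Proof.
move=> f0; have [pi0 _ _] := pi_stat.
have piK x := fineK (stationary_fin_num x).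
have pi0' x : 0 <= fine (pi x) by rewrite fine_ge0.
transitivity (\esum_(x in [set: S]) \esum_(y in [set: S])
    ((f y)%:E * (pi x * (r x y)%:E)))%E.
  apply: eq_esum => x _; rewrite -[in LHS]piK -ge0_esumZl//.
    by apply: eq_esum => y _; rewrite piK EFinM muleA muleC.
  by move=> y; rewrite lee_fin mulr_ge0.
rewrite esum_exchange; last by move=> x y; rewrite !mule_ge0// lee_fin.
apply: eq_esum => y _; rewrite ge0_esumZl//; last first.
  by move=> x; rewrite mule_ge0// lee_fin.
by rewrite stationary_balance muleC -muleA -EFinM.
Qed.

End stationary_balance.

(** * Expectations of functions of a countably valued random variable *)

Section discrete_law.
Context d (T : measurableType d) (R : realType) (P : probability T R).
Context (S : countType) (V : T -> S).
Hypothesis mV : forall x, measurable [set w | V w = x].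

(** Any preimage is a countable union of fibres of [V], so [F] may be arbitrary. *)
Lemma measurable_countable_comp d' (U : measurableType d') (F : S -> U) :
  measurable_fun [set: T] (F \o V).
Proof.
move=> _ B mB; rewrite setTI.
rewrite (_ : _ @^-1` _ = \bigcup_x [set w | V w = x /\ B (F x)]); last first.
  apply/seteqP; split=> [w Bw|w [x _ [/= <-]]//].
  by exists (V w).
apply: countable_bigcupT_measurable => [|x]; first exact: countableP.
have [Bx|nBx] := pselect (B (F x)).
  rewrite (_ : [set w | _] = [set w | V w = x])//.
  by apply/seteqP; split=> w //= [].
by rewrite (_ : [set w | _] = set0)//; apply/seteqP; split=> w //= [].
Qed.

Lemma ge0_integral_discrete_law (F : S -> R) : (forall x, 0 <= F x) ->
  (\int[P]_w (F (V w))%:E = \esum_(x in [set: S]) (P [set w | V w = x] * (F x)%:E))%E.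
Proof.
move=> F0.
(* The fibres of [V] are indexed by codes in [nat] to apply countable additivity; a code outside the
   range of [pickle] gives an empty set. *)
pose A k := [set w | choice.pickle (V w) = k].
have mA k : measurable (A k).
  rewrite (_ : A k = (choice.pickle \o V) @^-1` [set k])//.
  by rewrite -[X in measurable X]setTI; exact: (@measurable_countable_comp _ nat).
have cover : \bigcup_k A k = [set: T].
  by apply/seteqP; split=> // w _; exists (choice.pickle (V w)).
rewrite -{1}cover ge0_integral_bigcup//; last 3 first.
- rewrite cover; apply/measurable_EFinP.
  exact: (@measurable_countable_comp _ R F).
- by move=> w _; rewrite lee_fin.
- by move=> i j _ _ [w [/= <- <-]].
rewrite nneseries_esumT; last by move=> k; apply: integral_ge0 => w _; rewrite lee_fin.
rewrite (esumID (range (@choice.pickle S)))//; last first.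
  by move=> k _; apply: integral_ge0 => w _; rewrite lee_fin.
rewrite [X in (_ + X)%E]esum1 ?adde0; last first.
  move=> k [_ /= nk]; rewrite (_ : A k = set0) ?integral_set0//.
  by apply/seteqP; split=> // w /= wk; apply: nk; exists (V w).
rewrite setTI esum_image; last by move=> x y _ _; exact: (pcan_inj choice.pickleK).
apply: eq_esum => x _.
have -> : A (choice.pickle x) = [set w | V w = x].
  apply/seteqP; split=> w; rewrite /A/=; last by move=> ->.
  exact: (pcan_inj choice.pickleK).
rewrite (eq_integral (fun=> (F x)%:E)); last by move=> w /set_mem /= ->.
by rewrite integral_cst// muleC.
Qed.

End discrete_law.

Section probability_integrals.
Context d (T : measurableType d) (R : realType) (P : probability T R).
Implicit Types (F G H : T -> R).

Lemma bounded_integrable F (M : R) : measurable_fun [set: T] F ->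
  (forall w, `|F w| <= M) -> P.-integrable [set: T] (EFin \o F).
Proof.
move=> mF FM.
apply: (@le_integrable _ _ _ P [set: T] measurableT _ (fun=> M%:E)).
- exact/measurable_EFinP.
- by move=> w _ /=; rewrite lee_fin (le_trans (FM w))// ler_norm.
- exact: finite_measure_integrable_cst.
Qed.

Lemma Rintegral_prob_cst (c : R) : \int[P]_w c = c.
Proof.
rewrite Rintegral_cst// [X in fine X](_ : _ = 1%E) ?mulr1//.
exact: probability_setT.
Qed.

Lemma Rintegral_dist_le F G H :
  P.-integrable [set: T] (EFin \o F) -> P.-integrable [set: T] (EFin \o G) ->
  P.-integrable [set: T] (EFin \o H) -> (forall w, `|F w - G w| <= H w) ->
  `|\int[P]_w F w - \int[P]_w G w| <= \int[P]_w H w.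
Proof.
move=> iF iG iH FGH; rewrite -RintegralB//.
have iFG : P.-integrable [set: T] (EFin \o (fun w => F w - G w)).
  exact: (integrableB measurableT iF iG).
apply: le_trans (le_normr_Rintegral measurableT iFG) _.
by apply: le_Rintegral => //; exact: (integrable_norm iFG).
Qed.

End probability_integrals.

(** * Mean drifts in steady state *)

Section stationary_expectation.
Context (R : realType) (S : countType).
Variables (r : S -> S -> R) (e : S -> R) (C : R) (step : (S -> R) -> S -> R).
Hypothesis r_ge0 : forall x y, 0 <= r x y.
Hypothesis r_sum : forall x, (\esum_(y in [set: S]) (r x y)%:E = (e x)%:E)%E.
Hypothesis e_le : forall x, e x <= C.
Hypothesis stepE : forall f x, (forall y, 0 <= f y) ->
  (\esum_(y in [set: S]) (r x y * f y)%:E = (step f x)%:E)%E.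
Variables (Pt : R -> S -> S -> R).
Hypothesis Pt_ctmc :
  ctmc_transition (fun x y => r x y - (x == y)%:R * e x) Pt.
Context d (T : measurableType d) (P : probability T R) (V : T -> S).
Hypothesis mV : forall x, measurable [set w | V w = x].
Hypothesis V_stat : stationary_distribution Pt (fun x => P [set w | V w = x]).

Let e_ge0 := exit_rate_ge0 r_ge0 r_sum.

Let step_ge0 f x : (forall y, 0 <= f y) -> 0 <= step f x.
Proof.
move=> f0; rewrite -lee_fin -stepE//; apply: esum_ge0 => y _.
by rewrite lee_fin mulr_ge0.
Qed.

Let le_step f g x : (forall y, 0 <= f y) -> (forall y, f y <= g y) ->
  step f x <= step g x.
Proof.
move=> f0 fg; rewrite -lee_fin -!stepE//; last first.
  by move=> y; exact: le_trans (fg y).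
by apply: le_esum => y _; rewrite lee_fin ler_wpM2l.
Qed.

Let step_cst c x : 0 <= c -> step (fun=> c) x = c * e x.
Proof.
move=> c0; apply: EFin_inj; rewrite -stepE// EFinM -r_sum -ge0_esumZl//.
  by apply: eq_esum => y _; rewrite mulrC EFinM.
by move=> y; rewrite lee_fin.
Qed.

Let mF (F : S -> R) : measurable_fun [set: T] (fun w => (F (V w))%:E).
Proof. by apply/measurable_EFinP; exact: (measurable_countable_comp mV). Qed.

Let integralD_law (F G : S -> R) : (forall x, 0 <= F x) -> (forall x, 0 <= G x) ->
  (\int[P]_w (F (V w))%:E + \int[P]_w (G (V w))%:E =
   \int[P]_w (F (V w) + G (V w))%:E)%E.
Proof.
move=> F0 G0; by rewrite -ge0_integralD//;
  do ?[exact: (mF F)|exact: (mF G)|by move=> w _; rewrite lee_fin].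
Qed.

Let le_integral_law (F G : S -> R) : (forall x, 0 <= F x) ->
  (forall x, F x <= G x) ->
  (\int[P]_w (F (V w))%:E <= \int[P]_w (G (V w))%:E)%E.
Proof.
by move=> F0 FG; apply: ge0_le_integral => //;
  do ?[exact: (mF F)|exact: (mF G)|by move=> w _; rewrite lee_fin].
Qed.

Lemma integral_stationary_flow f : (forall x, 0 <= f x) ->
  (\int[P]_w (step f (V w))%:E = \int[P]_w (e (V w) * f (V w))%:E)%E.
Proof.
move=> f0.
rewrite (ge0_integral_discrete_law P mV (F := step f)); last first.
  by move=> x; exact: step_ge0.
rewrite (ge0_integral_discrete_law P mV (F := fun x => e x * f x)); last first.
  by move=> x; rewrite mulr_ge0.
rewrite -(stationary_flow r_ge0 r_sum e_le Pt_ctmc V_stat)//.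
by apply: eq_esum => x _; rewrite stepE.
Qed.

(* The drift inequality survives truncating f at height N, and truncated
   functions have zero mean drift. *)
Lemma stationary_drift_le f g h : (forall x, 0 <= f x) -> (forall x, 0 <= g x) ->
  (forall x, 0 <= h x) -> (forall x, step f x - e x * f x <= h x - g x) ->
  (\int[P]_w (g (V w))%:E <= \int[P]_w (h (V w))%:E)%E.
Proof.
move=> f0 g0 h0 drift.
have truncated (N : R) : 0 <= N ->
    (\int[P]_w ((f (V w) <= N)%R%:R * g (V w))%:E <= \int[P]_w (h (V w))%:E)%E.
  move=> N0.
  pose fN x := Num.min (f x) N.
  have fN0 x : 0 <= fN x by rewrite le_min f0.
  (* The zero mean drift of [fN] enters by keeping its inflow integral on both sides; this integral
     is at most [C * N], hence finite, and is cancelled afterwards. *)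
  have mixed : (\int[P]_w (step fN (V w))%:E
        + \int[P]_w ((f (V w) <= N)%R%:R * g (V w))%:E <=
      \int[P]_w (step fN (V w))%:E + \int[P]_w (h (V w))%:E)%E.
    have gN0 x : 0 <= (f x <= N)%R%:R * g x by rewrite mulr_ge0.
    rewrite {2}integral_stationary_flow//.
    rewrite (integralD_law (F := step fN) _ gN0); last by move=> x; exact: step_ge0.
    rewrite (integralD_law (F := fun x => e x * fN x)) => [||//]; last first.
      by move=> x; rewrite mulr_ge0.
    apply: (le_integral_law 
      (F := fun x => step fN x + (f x <= N)%R%:R * g x)
      (G := fun x => e x * fN x + h x)) => x.
      by rewrite addr_ge0// step_ge0.
    (* Below height [N] the drift of [fN] is at most that of [f]. Above it, [fN] is at its maximum,
       so its drift is nonpositive and [h x >= 0] suffices. *)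
    have [fxN|Nfx] := leP (f x) N.
      rewrite mul1r; have -> : fN x = f x by apply/min_idPl.
      have := drift x; have : step fN x <= step f x.
        by apply: le_step => // y; rewrite ge_min lexx.
      by move=> ? ?; lra.
    rewrite mul0r addr0; have -> : fN x = N by apply/min_idPr/ltW.
    have : step fN x <= step (fun=> N) x.
      by apply: le_step => // y; rewrite ge_min lexx orbT.
    rewrite step_cst// => ?; have := h0 x => ?; lra.
  rewrite leeD2lE// in mixed.
  rewrite ge0_fin_numE; last first.
    by apply: integral_ge0 => w _; rewrite lee_fin step_ge0.
  rewrite integral_stationary_flow//.
  apply: (@le_lt_trans _ _ (\int[P]_w (cst (C * N)%:E w))%E).
    apply: (le_integral_law (F := fun x => e x * fN x) (G := fun=> C * N)) => x.
      by rewrite mulr_ge0.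
    by rewrite ler_pM// ge_min lexx orbT.
  rewrite integral_cst// [X in (_ * X)%E](_ : _ = 1%E) ?mule1 ?ltry//.
  exact: probability_setT.
rewrite (ge0_integral_discrete_law P mV (F := g))//.
apply: ge_ereal_sup => _ [X [finX _] <-].
(* A height above every value of [f] on [X], so that the indicator equals 1 on all of [X]. *)
pose N := \sum_(x <- fset_set X) f x.
have N0 : 0 <= N by apply: sumr_ge0.
apply: le_trans (truncated N N0).
rewrite (ge0_integral_discrete_law P mV (F := fun x => (f x <= N)%R%:R * g x)); last first.
  by move=> x; rewrite mulr_ge0.
apply: esum_ge; exists X => //.
rewrite !fsbig_finite//= big_seq [leRHS]big_seq; apply: lee_sum => x xX.
by rewrite /N (big_fsetD1 x)//= lerDl sumr_ge0//= ?mul1r.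
Qed.

(** Bounded exit rates make [e * f] integrable together with [f]; by the flow identity the inflow
    term has the same finite integral, so the two may be subtracted. *)
Lemma stationary_drift_eq0 f : (forall x, 0 <= f x) ->
  P.-integrable [set: T] (fun w => (f (V w))%:E) ->
  P.-integrable [set: T] (fun w => (step f (V w) - e (V w) * f (V w))%:E) /\
  \int[P]_w (step f (V w) - e (V w) * f (V w)) = 0.
Proof.
move=> f0 intf.
have intef : P.-integrable [set: T] (fun w => (e (V w) * f (V w))%:E).
  have intC : P.-integrable [set: T] (fun w => (C%:E * (f (V w))%:E)%E).
    exact: integrableZl.
  apply: le_integrable intC => //; first exact: (mF (fun x => e x * f x)).
  move=> w _ /=; rewrite lee_fin !ger0_norm ?mulr_ge0//.
    by rewrite ler_wpM2r.
  exact: le_trans (e_ge0 _) (e_le (V w)).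
have intstep : P.-integrable [set: T] (fun w => (step f (V w))%:E).
  apply/integrableP; split; first exact: (mF (step f)).
  rewrite (eq_integral (fun w => (step f (V w))%:E)); last first.
    by move=> w _; rewrite gee0_abs// lee_fin step_ge0.
  rewrite integral_stationary_flow//.
  case/integrableP : intef => _; apply: le_lt_trans.
  apply: ge0_le_integral => //.
  - by move=> w _; rewrite lee_fin mulr_ge0.
  - exact: (mF (fun x => e x * f x)).
  - by apply: measurableT_comp => //; exact: (mF (fun x => e x * f x)).
  - by move=> w _; exact: lee_abs.
split; first by have := integrableB measurableT intstep intef.
rewrite RintegralB//.
by rewrite /Rintegral integral_stationary_flow// subrr.
Qed.

End stationary_expectation.

(** * Drifts in the JSQ chain *)

Section jsq_states.
Context (R : realType) (n : nat).
Hypothesis n_gt0 : (0 < n)%N.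
Implicit Types x : jsq_state n.

Definition total x : nat := (\sum_i x i)%N.

Definition busy x : nat := #|[set i | (0 < x i)%N]|.

(* The default 0 is only reached for n = 0. *)
Definition shortest x : nat :=
  if [pick i in shortest_queues x] is Some i then x i else 0%N.

Definition mean_queue x : R := (total x)%:R / n%:R.

Definition queue_gap x : R := mean_queue x - (shortest x)%:R.

Definition excess x (i : 'I_n) : R := (x i)%:R - mean_queue x.

Definition exp_excess (c : R) x : R := \sum_i expR (c * excess x i).

Lemma shortest_queues_gt0 x : (0 < #|shortest_queues x|)%N.
Proof.
apply/card_gt0P; have [i _ xi] := arg_minnP x (erefl (xpredT (Ordinal n_gt0))).
by exists i; rewrite inE; apply/forallP => j; exact: xi.
Qed.

Lemma shortestP x : {i | i \in shortest_queues x & shortest x = x i}.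
Proof.
rewrite /shortest; case: pickP => [i xi|x0]; first by exists i.
by have := shortest_queues_gt0 x; rewrite (eq_card0 x0).
Qed.

Lemma shortest_le x i : (shortest x <= x i)%N.
Proof. by have [j + ->] := shortestP x; rewrite inE => /forallP; exact. Qed.

Lemma shortest_queuesE x i : i \in shortest_queues x -> x i = shortest x.
Proof.
have [j jx ->] := shortestP x; move: jx; rewrite !inE => /forallP jx /forallP ix.
by apply/eqP; rewrite eqn_leq jx ix.
Qed.

Lemma busy_le x : (busy x <= n)%N.
Proof. by rewrite -[leqRHS]card_ord max_card. Qed.

Lemma shortest_idle x : (busy x < n)%N -> shortest x = 0%N.
Proof.
move=> bx; apply/eqP; rewrite -leqn0 leqNgt; apply/negP => s0.
move: bx; have -> : busy x = #|'I_n|; last by rewrite card_ord ltnn.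
apply: eq_card => i; rewrite inE; apply/mem_set => /=.
exact: leq_trans s0 (shortest_le _ _).
Qed.

Lemma total_add x i : total (add_job x i) = (total x).+1.
Proof.
rewrite /total; under eq_bigr do rewrite ffunE.
rewrite big_split/= -addn1; congr addn.
by rewrite (bigD1 i)//= eqxx big1// => j /negPf ->.
Qed.

Lemma remove_jobK x i : (0 < x i)%N -> add_job (remove_job x i) i = x.
Proof.
move=> xi; apply/ffunP => j; rewrite !ffunE subnK//.
by case: eqP => [->|].
Qed.

Lemma total_remove x i : (0 < x i)%N -> total x = (total (remove_job x i)).+1.
Proof. by move=> xi; rewrite -(total_add _ i) remove_jobK. Qed.

Let nR0 : (n%:R : R) != 0. Proof. by rewrite pnatr_eq0 -lt0n. Qed.

Lemma excess_add x i j :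
  excess (add_job x i) j = excess x j + (j == i)%:R - n%:R^-1.
Proof.
rewrite /excess /mean_queue total_add ffunE natrD -natr1.
by rewrite mulrDl mul1r; ring.
Qed.

Lemma sum_excess x : \sum_i excess x i = 0.
Proof.
rewrite sumrB sumr_const card_ord -[mean_queue x *+ n]mulr_natr divfK//.
by rewrite /total natr_sum subrr.
Qed.

(** The mean rises by 1/n, which multiplies all summands by e^(-c/n); only the summand of [i] gains
    a further factor e^c. *)
Lemma exp_excess_add c x i : exp_excess c (add_job x i) =
  expR (- c / n%:R) *
    (exp_excess c x + (expR c - 1) * expR (c * excess x i)).
Proof.
rewrite /exp_excess (bigD1 i)//= [in RHS](bigD1 i)//=.
have -> : \sum_(j | j != i) expR (c * excess (add_job x i) j) =
    expR (- c / n%:R) * \sum_(j | j != i) expR (c * excess x j).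
  rewrite mulr_sumr; apply: eq_bigr => j /negPf ji.
  by rewrite excess_add ji addr0 -expRD; congr expR; ring.
have -> : expR (c * excess (add_job x i) i) =
    expR (- c / n%:R) * (expR c * expR (c * excess x i)).
  by rewrite excess_add eqxx mulr1n -!expRD; congr expR; ring.
ring.
Qed.

(** The arrival identity at [remove_job x i], solved for the state before the arrival; nonemptiness
    of queue [i] makes the truncated subtraction exact. *)
Lemma exp_excess_remove c x i : (0 < x i)%N ->
  exp_excess c (remove_job x i) =
  expR (c / n%:R) *
    (exp_excess c x + (expR (- c) - 1) * expR (c * excess x i)).
Proof.
move=> xi; set y := remove_job x i.
have -> : excess x i = excess y i + 1 - n%:R^-1.
  by rewrite -[in LHS](remove_jobK xi) excess_add eqxx mulr1n.
rewrite -{1}(remove_jobK xi) exp_excess_add -/y.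
have -> : c * (excess y i + 1 - n%:R^-1) =
  c + c * excess y i + - c / n%:R by ring.
rewrite !expRD !expRN mulNr expRN.
have := expR_gt0 c; have := expR_gt0 (c / n%:R) => ? ?.
by field; rewrite !gt_eqF.
Qed.

Lemma exp_excess_ge0 c x : 0 <= exp_excess c x.
Proof. by apply: sumr_ge0 => i _; exact: expR_ge0. Qed.

Lemma excess_shortest x i : i \in shortest_queues x -> excess x i = - queue_gap x.
Proof. by move=> /shortest_queuesE xi; rewrite /queue_gap opprB -xi. Qed.

Lemma excess_ge x i : - queue_gap x <= excess x i.
Proof. by rewrite /queue_gap opprB lerD2r ler_nat shortest_le. Qed.

Lemma queue_gap_ge0 x : 0 <= queue_gap x.
Proof.
rewrite -(@pmulr_rge0 _ n%:R) ?ltr0n// -oppr_le0 -mulrN.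
rewrite -(sum_excess x) mulrC mulr_natr -[X in _ *+ X]card_ord -sumr_const.
by apply: ler_sum => i _; exact: excess_ge.
Qed.

End jsq_states.

Section jsq_drift.
Context (R : realType) (n : nat) (lambda mu : R).
Hypothesis n_gt0 : (0 < n)%N.
Hypothesis lambda_ge0 : 0 <= lambda.
Hypothesis mu_gt0 : 0 < mu.
Implicit Types (x : jsq_state n) (f : jsq_state n -> R).

Definition jsq_exit x : R := lambda + mu * (busy x)%:R.

(** The off-diagonal part of the generator applied to [f], as a finite sum over events rather than
    an infinite sum over target states; [esum_jsq_step] identifies the two. *)
Definition jsq_step f x : R :=
  \sum_(i in shortest_queues x)
     lambda / #|shortest_queues x|%:R * f (add_job x i)
  + \sum_(i | (0 < x i)%N) mu * f (remove_job x i).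

Lemma jsq_rate_ge0 x y : 0 <= jsq_rate lambda mu x y.
Proof.
by rewrite addr_ge0//; apply: sumr_ge0 => i _; rewrite mulr_ge0// ?divr_ge0// ltW.
Qed.

Let esum_point (c : R) (z : jsq_state n) f : 0 <= c -> (forall y, 0 <= f y) ->
  (\esum_(y in [set: jsq_state n]) (c * (y == z)%:R * f y)%:E = (c * f z)%:E)%E.
Proof.
move=> c0 f0; rewrite (esumID [set z])//; last first.
  by move=> y _; rewrite lee_fin !mulr_ge0.
rewrite setTI esum_set1; last by rewrite lee_fin !mulr_ge0.
rewrite eqxx mulr1 esum1 ?adde0// => y [_ /= /eqP/negPf ->].
by rewrite mulr0 mul0r.
Qed.

Lemma esum_jsq_step f x : (forall y, 0 <= f y) ->
  (\esum_(y in [set: jsq_state n]) (jsq_rate lambda mu x y * f y)%:E =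
   (jsq_step f x)%:E)%E.
Proof.
move=> f0; have c0 : 0 <= lambda / #|shortest_queues x|%:R by rewrite divr_ge0.
have mu0 := ltW mu_gt0.
under eq_esum do rewrite mulrDl EFinD !mulr_suml -!sumEFin.
rewrite esumD; first last.
- by move=> y _; apply: sume_ge0 => i _; rewrite lee_fin !mulr_ge0.
- by move=> y _; apply: sume_ge0 => i _; rewrite lee_fin !mulr_ge0.
rewrite !esum_sum; first last.
- by move=> y i _ _; rewrite lee_fin !mulr_ge0.
- by move=> y i _ _; rewrite lee_fin !mulr_ge0.
rewrite /jsq_step EFinD -!sumEFin.
by congr (_ + _)%E; apply: eq_bigr => i _; exact: esum_point.
Qed.

Lemma busyE x : busy x = (\sum_(i | (0 < x i)%N) 1)%N.
Proof. by rewrite sum1_card; apply: eq_card => i; apply/idP/idP => [/set_mem|/mem_set]. Qed.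

Let sum_arrivals x (a : R) :
  \sum_(i in shortest_queues x) lambda / #|shortest_queues x|%:R * a = lambda * a.
Proof.
rewrite sumr_const -[LHS]mulr_natr mulrAC divfK// pnatr_eq0 -lt0n.
exact: shortest_queues_gt0.
Qed.

Let sum_departures x (a : R) :
  \sum_(i | (0 < x i)%N) mu * a = mu * (busy x)%:R * a.
Proof.
rewrite busyE natr_sum !mulr_sumr mulr_suml.
by apply: eq_bigr => i _; rewrite mulr1.
Qed.

Lemma esum_jsq_rate x :
  (\esum_(y in [set: jsq_state n]) (jsq_rate lambda mu x y)%:E =
   (jsq_exit x)%:E)%E.
Proof.
under eq_esum do rewrite -[jsq_rate _ _ _ _]mulr1.
rewrite (esum_jsq_step (f := fun=> 1))//.
by rewrite /jsq_step sum_arrivals sum_departures !mulr1.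
Qed.

Lemma jsq_exit_le x : jsq_exit x <= lambda + mu * n%:R.
Proof. by rewrite lerD2l ler_pM2l// ler_nat busy_le. Qed.

Lemma jsq_step_exp theta x :
  jsq_step (fun y => expR (theta * (total y)%:R)) x =
  (lambda * expR theta + mu * (busy x)%:R * expR (- theta))
  * expR (theta * (total x)%:R).
Proof.
pose E := expR (theta * (total x)%:R).
transitivity (lambda * (expR theta * E) + mu * (busy x)%:R * (expR (- theta) * E)).
  rewrite -(sum_arrivals x) -(sum_departures x) /E.
  congr (_ + _); apply: eq_bigr => i xi; congr (_ * _).
    by rewrite total_add -natr1 -expRD; congr expR; ring.
  by rewrite (total_remove xi) -natr1 -expRD; congr expR; ring.
by rewrite /E; ring.
Qed.

Lemma jsq_step_total x :
  jsq_step (fun y => (total y)%:R) x =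
  lambda * ((total x)%:R + 1) + mu * (busy x)%:R * ((total x)%:R - 1).
Proof.
rewrite -(sum_arrivals x) -(sum_departures x).
congr (_ + _); apply: eq_bigr => i xi; congr (_ * _).
  by rewrite total_add -natr1.
by rewrite (total_remove xi) -natr1 addrK.
Qed.

(** Every queue that an arrival may join has excess [- queue_gap R x], so averaging over ties
    disappears; only the departures keep a sum over queues. *)
Lemma jsq_step_exp_excess c x : jsq_step (exp_excess c) x =
  lambda * expR (- c / n%:R)
    * (exp_excess c x + (expR c - 1) * expR (- c * queue_gap R x))
  + mu * expR (c / n%:R) * ((busy x)%:R * exp_excess c x
    + (expR (- c) - 1) * \sum_(i | (0 < x i)%N) expR (c * excess R x i)).
Proof.
congr (_ + _).
  rewrite -mulrA -[RHS](sum_arrivals x); apply: eq_bigr => i xi; congr (_ * _).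
  by rewrite exp_excess_add// (excess_shortest _ n_gt0 xi) mulrN -mulNr.
under eq_bigr => i xi do rewrite exp_excess_remove// mulrA mulrDr.
rewrite big_split/= mulrDr; congr (_ + _).
  rewrite [RHS](_ : _ = mu * (busy x)%:R * (expR (c / n%:R) * exp_excess c x)).
    rewrite -(sum_departures x). by apply: eq_bigr => i _; rewrite mulrA.
  by ring.
by rewrite !mulr_sumr; apply: eq_bigr => i _; ring.
Qed.

End jsq_drift.

(** * Drift bounds for exponential sums of the excesses *)

Section jsq_lyapunov.
Context (R : realType) (n : nat) (lambda mu eps : R).
Hypothesis n_gt0 : (0 < n)%N.
Hypothesis mu_gt0 : 0 < mu.
Hypothesis eps_ge0 : 0 <= eps.
Hypothesis eps_le1 : eps <= 1.
Hypothesis lambdaE : lambda = n%:R * mu * (1 - eps).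
Implicit Types (x : jsq_state n).

Local Notation drift f x :=
  (jsq_step lambda mu f x - jsq_exit lambda mu x * f x).

Let n0 : 0 < n%:R :> R. Proof. by rewrite ltr0n. Qed.

Let lambda_le : lambda <= mu * n%:R.
Proof.
rewrite lambdaE mulrC [leRHS]mulrC ler_piMl ?gerBl//.
by rewrite mulr_ge0// ltW.
Qed.

Let lambda_ge0 : 0 <= lambda.
Proof. by rewrite lambdaE !mulr_ge0 ?subr_ge0// ltW. Qed.

(** An empty queue has nonpositive excess and contributes at most 1 to the sum. *)
Lemma exp_excess_le_busy c x : 0 <= c ->
  exp_excess c x - n%:R <= \sum_(i | (0 < x i)%N) expR (c * excess R x i).
Proof.
move=> c0; rewrite lerBlDr /exp_excess (bigID (fun i => 0 < x i)%N)/= lerD2l.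
apply: (@le_trans _ _ (\sum_(i | ~~ (0 < x i)%N) 1)).
  apply: ler_sum => i; rewrite -eqn0Ngt => /eqP xi.
  rewrite -expR0 ler_expR mulr_ge0_le0// /excess xi sub0r oppr_le0.
  by rewrite divr_ge0.
rewrite sumr_const ler_nat -[leqRHS]card_ord; exact: max_card.
Qed.

(** The left side of [decay] bounds the coefficient of [mu * exp_excess c x]. Shifts of the mean by
    arrivals and departures cancel to first order, which leaves the term with n; [eps * c] arises
    because arrivals are slower than n mu; [1 - expR (- c)] is the gain at busy queues. Arrivals
    join queues of excess at most 0 and cost only a constant times n. *)
Lemma drift_exp_excess_le c x : 0 < c ->
  n%:R * (expR (c / n%:R) + expR (- c / n%:R) - 2) + eps * c
    - (1 - expR (- c)) <= - 4^-1 ->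
  drift (exp_excess c) x <= mu * n%:R * expR c - mu / 4 * exp_excess c x.
Proof.
move=> c0 decay.
rewrite jsq_step_exp_excess// /jsq_exit.
set W := exp_excess c x; set D := \sum_(i | _) _; set b := (busy x)%:R.
set E1 := expR (- c / n%:R) in decay *; set E2 := expR (c / n%:R) in decay *.
set ec := expR c; set ic := expR (- c) in decay *; set G := expR (_ * _).
have W0 : 0 <= W := exp_excess_ge0 c x.
have D0 : 0 <= D by apply: sumr_ge0 => i _; exact: expR_ge0.
have DW : W - n%:R <= D by apply: exp_excess_le_busy; exact: ltW.
have bn : b <= n%:R by rewrite ler_nat busy_le.
have b0 : 0 <= b by [].
have cn0 : 0 <= c / n%:R by rewrite divr_ge0// ltW.
have E1gt0 : 0 < E1 := expR_gt0 _.
have E1le1 : E1 <= 1 by rewrite -expR0 ler_expR mulNr oppr_le0.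
have E2ge1 : 1 <= E2 by rewrite -expR0 ler_expR.
have ecge1 : 1 <= ec by rewrite -expR0 ler_expR ltW.
have ic0 : 0 < ic := expR_gt0 _.
have icle1 : ic <= 1 by rewrite -expR0 ler_expR oppr_le0 ltW.
have G0 : 0 <= G := expR_ge0 _.
have Gle1 : G <= 1.
  by rewrite -expR0 ler_expR mulNr oppr_le0 mulr_ge0 ?queue_gap_ge0// ltW.
have E1c : n%:R * (1 - E1) <= c.
  have : 1 - c / n%:R <= E1 by rewrite /E1 mulNr; exact: expR_ge1Dx.
  rewrite -(ler_pM2l n0) mulrBr mulrCA divff ?gt_eqF// !mulr1 => ?; lra.
have mu0 := ltW mu_gt0.
have H1 : mu * b * (E2 - 1) * W <= mu * n%:R * (E2 - 1) * W.
  by rewrite ler_wpM2r// ler_wpM2r ?subr_ge0// ler_wpM2l.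
have H2 : lambda * E1 * (ec - 1) * G <= mu * n%:R * (ec - 1).
  rewrite -[leRHS]mulr1; apply: ler_pM => //.
    by rewrite !mulr_ge0 ?subr_ge0// ltW.
  rewrite ler_wpM2r ?subr_ge0//; apply: le_trans lambda_le.
  by rewrite ler_piMr.
have H3 : mu * (1 - ic) * (W - n%:R) <= mu * E2 * (1 - ic) * D.
  apply: (@le_trans _ _ (mu * (1 - ic) * D)).
    by rewrite ler_wpM2l// mulr_ge0// subr_ge0.
  rewrite ler_wpM2r// ler_wpM2r ?subr_ge0//.
  by rewrite ler_peMr.
have H4 : lambda * (E1 - 1) * W <= mu * (n%:R * (E1 - 1) + eps * c) * W.
  rewrite ler_wpM2r// lambdaE.
  have -> : n%:R * mu * (1 - eps) * (E1 - 1) =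
    mu * (n%:R * (E1 - 1) + eps * (n%:R * (1 - E1))) by ring.
  by rewrite ler_wpM2l// lerD2l ler_wpM2l.
have H5 := ler_wpM2l mu0 (ler_wpM2r W0 decay).
have H6 : mu * n%:R * (ec - 1) + mu * n%:R * (1 - ic) <= mu * n%:R * ec.
  have : 0 <= mu * n%:R * ic by rewrite !mulr_ge0// ltW.
  lra.
lra.
Qed.

(** The 5 is 2 + 3: arrivals raise the mean, at cost n (e^(1/n) - 1) <= 2 for n >= 2, and departures
    deepen a deficit by the factor e, where e - 1 <= 3. The 1/4 is the product of [1 - eps >= 1/2]
    and [1 - expR (-1) >= 1/2]. *)
Lemma drift_exp_deficit_le x : (1 < n)%N -> eps <= 2^-1 ->
  drift (exp_excess (- 1)) x <=
  mu * (5 * exp_excess (- 1) x) - mu * n%:R / 4 * expR (queue_gap R x).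
Proof.
move=> n1 eps2.
rewrite jsq_step_exp_excess// /jsq_exit !opprK !mul1r.
set W := exp_excess _ x; set D := \sum_(i | _) _; set b := (busy x)%:R.
set E1 := expR (n%:R^-1); set E2 := expR (-1 / n%:R).
set G := expR (queue_gap R x).
have W0 : 0 <= W := exp_excess_ge0 _ x.
have D0 : 0 <= D by apply: sumr_ge0 => i _; exact: expR_ge0.
have DW : D <= W.
  rewrite /W /exp_excess (bigID (fun i => 0 < x i)%N)/= lerDl.
  by apply: sumr_ge0 => i _; exact: expR_ge0.
have b0 : 0 <= b by [].
have E2gt0 : 0 < E2 := expR_gt0 _.
have E2le1 : E2 <= 1.
  by rewrite -expR0 ler_expR mulNr oppr_le0 divr_ge0.
have E1ge1 : 1 <= E1 by rewrite -expR0 ler_expR invr_ge0.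
have G0 : 0 <= G := expR_ge0 _.
have i2 : expR (-1) <= 2^-1 :> R.
  rewrite expRN lef_pV2 ?posrE ?expR_gt0//.
  by have := expR_ge1Dx (1 : R); lra.
have i0 : 0 < expR (-1) :> R := expR_gt0 _.
(* Squaring e^(-1/2) >= 1/2 gives e <= 4. *)
have e4 : expR 1 - 1 <= 3 :> R.
  have h2 : 2^-1 <= expR (- 2^-1) :> R.
    by have := expR_ge1Dx (- 2^-1 : R); lra.
  have h4 : 4^-1 <= expR (-1) :> R.
    have -> : expR (-1) = expR (- 2^-1) * expR (- 2^-1) :> R.
      by rewrite -expRD; congr expR; lra.
    by nra.
  have : expR 1 <= 4 :> R.
    by rewrite -[leRHS]invrK -[leLHS]invrK -expRN lef_pV2 ?posrE ?expR_gt0.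
  lra.
have e0 : 0 <= expR 1 - 1 :> R.
  by have := expR_ge1Dx (1 : R); lra.
have E1b : n%:R * (E1 - 1) <= 2.
  have n2 : 2 <= n%:R :> R by rewrite (ler_nat _ 2).
  have h : 1 - n%:R^-1 <= E1^-1 by rewrite -expRN; exact: expR_ge1Dx.
  have {}h : n%:R - 1 <= n%:R * E1^-1.
    by rewrite -(ler_pM2l n0) mulrBr divff ?gt_eqF// mulr1 in h.
  have E1gt0 : 0 < E1 := expR_gt0 _.
  have {}h : (n%:R - 1) * E1 <= n%:R.
    by rewrite -(ler_pM2r E1gt0) mulfVK ?gt_eqF// in h.
  nra.
have mu0 := ltW mu_gt0.
have H1 : mu * b * (E2 - 1) * W <= 0.
  by rewrite mulr_le0_ge0// mulr_ge0_le0 ?subr_le0// mulr_ge0.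
have H2 : lambda * (E1 - 1) * W <= mu * 2 * W.
  rewrite ler_wpM2r//; apply: (@le_trans _ _ (mu * n%:R * (E1 - 1))).
    by rewrite ler_wpM2r// subr_ge0.
  by rewrite -mulrA ler_wpM2l.
have H3 : mu * E2 * (expR 1 - 1) * D <= mu * 3 * W.
  apply: ler_pM => //; first by rewrite !mulr_ge0// ltW.
  apply: ler_pM => //; first by rewrite !mulr_ge0// ltW.
  by rewrite ler_piMr.
have H4 : mu * n%:R / 4 * G <= lambda * E1 * (1 - expR (-1)) * G.
  rewrite ler_wpM2r//; apply: (@le_trans _ _ (lambda * (1 - expR (-1)))).
    rewrite lambdaE.
    have : 4^-1 <= (1 - eps) * (1 - expR (-1)) by nra.
    have nm : 0 <= n%:R * mu by rewrite mulr_ge0// ltW.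
    move=> /(ler_wpM2l nm); lra.
  rewrite ler_wpM2r ?ler_peMr//; lra.
lra.
Qed.
End jsq_lyapunov.

Section jsq_deficit.
Context (R : realType) (n : nat).
Hypothesis n_gt0 : (0 < n)%N.
Implicit Types (x : jsq_state n).

Let n0 : 0 < n%:R :> R. Proof. by rewrite ltr0n. Qed.

(* The numbers q_j - qbar have mean zero, so the deficits have the same average
   A as the positive excesses; hence either A is small compared with the gap Y,
   and few queues lie far below the mean, or e^Y is already dominated by e^(160A),
   which Jensen bounds by the exponential excesses. *)
Lemma exp_deficit_le x : exp_excess (-1) x <=
  n%:R * (21 + expR (queue_gap R x) / 40) + exp_excess 160 x.
Proof.
set Y := queue_gap R x; have Y0 : 0 <= Y := queue_gap_ge0 R n_gt0 x.
set G := expR Y; have G0 : 0 < G := expR_gt0 _.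
pose t i := excess R x i.
pose A := (\sum_i Num.max (t i) 0) / n%:R.
have An : A * n%:R = \sum_i Num.max (t i) 0 by rewrite divfK ?gt_eqF.
have Adef : A * n%:R = \sum_i Num.max (- t i) 0.
  apply/eqP; rewrite An -subr_eq0 -sumrB -[X in _ == X](sum_excess R n_gt0 x).
  apply/eqP/eq_bigr => i _; rewrite -/(t i).
  have [ti|ti] := leP 0 (t i).
    by rewrite max_r ?oppr_le0// subr0.
  by rewrite max_l ?oppr_ge0 ?ltW// sub0r opprK.
have tY i : - t i <= Y by rewrite lerNl; exact: excess_ge.
have W0 : 0 <= exp_excess (160 : R) x := exp_excess_ge0 _ x.
have [AY|YA] := leP A (Y / 160).
  (* Deficits up to Y/2 cost e^(Y/2). A larger one costs at most [G], and is charged the factor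
     deficit / (Y/2), which exceeds 1, as in Markov's inequality. *)
  have pointwise i : expR (- 1 * t i) <= expR (Y / 2) + Num.max (- t i) 0 * (2 / Y * G).
    rewrite mulN1r; have [tY2|tY2] := leP (- t i) (Y / 2).
      apply: (@le_trans _ _ (expR (Y / 2))); first by rewrite ler_expR.
      by rewrite lerDl !mulr_ge0 ?invr_ge0 ?le_max ?lexx ?orbT// ltW.
    have Ypos : 0 < Y.
      by rewrite lt0r Y0 andbT; apply/eqP => Y_eq0; have := tY i; lra.
    apply: (@le_trans _ _ (Num.max (- t i) 0 * (2 / Y * G))); last first.
      by rewrite lerDr expR_ge0.
    apply: (@le_trans _ _ G); first by rewrite ler_expR.
    rewrite mulrA ler_peMl ?ltW// max_l; last by lra.
    by rewrite mulrA ltr_pdivlMr// mul1r; lra.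
  (* From (e^(Y/2) - 40)^2 >= 0. *)
  have half : expR (Y / 2) <= 20 + G / 80.
    have GE : G = expR (Y / 2) ^+ 2.
      by rewrite expr2 -expRD -splitr.
    rewrite GE; have := sqr_ge0 (expR (Y / 2) - 40).
    by rewrite sqrrB; lra.
  apply: (@le_trans _ _ (n%:R * expR (Y / 2) + A * n%:R * (2 / Y * G))).
    rewrite Adef mulr_suml mulr_natl -[X in _ *+ X]card_ord -sumr_const -big_split/=.
    exact: ler_sum.
  have AYG : A * n%:R * (2 / Y * G) <= n%:R * (G / 80).
    (* For [Y = 0] the quotient [2 / Y] is 0 by convention and the left side vanishes. *)
    have [Y_eq0|Y_neq0] := eqVneq Y 0.
      by rewrite Y_eq0 invr0 mulr0 mul0r mulr0 mulr_ge0// ltW// divr_gt0.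
    have -> : A * n%:R * (2 / Y * G) = n%:R * (A * 2 / Y * G) by ring.
    rewrite ler_wpM2l// [leRHS]mulrC ler_wpM2r ?(ltW G0)//.
    have Ypos : 0 < Y by rewrite lt0r Y_neq0.
    rewrite ler_pdivrMr//; lra.
  have := ler_wpM2l (ltW n0) half; have := ltW n0; lra.
(* Jensen's inequality through the tangent of e^z at z = 160 A: the linear terms sum to 0 because
   [A] is the mean. Replacing a negative excess by 0 costs 1 per queue, hence the extra n. *)
have jensen : n%:R * expR (160 * A) <= n%:R + exp_excess 160 x.
  have -> : n%:R * expR (160 * A) =
      \sum_(i < n) expR (160 * A) * (1 + (160 * Num.max (t i) 0 - 160 * A)).
    rewrite -mulr_sumr big_split/= sumrB -mulr_sumr -An !sumr_const card_ord.
    by rewrite -[160 * A *+ n]mulr_natr; ring.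
  have -> : n%:R = \sum_(i < n) 1 :> R by rewrite sumr_const card_ord.
  rewrite -big_split/=; apply: ler_sum => i _.
  apply: (@le_trans _ _ (expR (160 * Num.max (t i) 0))).
    set M := Num.max _ _.
    have -> : expR (160 * M) = expR (160 * A) * expR (160 * M - 160 * A).
      by rewrite -expRD; congr expR; ring.
    by rewrite ler_wpM2l ?expR_ge0// expR_ge1Dx.
  rewrite -/(t i); have [ti|ti] := leP (t i) 0.
    by rewrite mulr0 expR0 lerDl expR_ge0.
  by rewrite lerDr.
have bound : exp_excess (-1) x <= n%:R * expR (160 * A).
  rewrite mulr_natl -[X in _ *+ X]card_ord -sumr_const; apply: ler_sum => i _.
  rewrite ler_expR mulN1r; apply: le_trans (tY i) _; lra.
have : 0 <= n%:R * G by rewrite mulr_ge0// ltW.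
have := ltW n0; lra.
Qed.

End jsq_deficit.

(** For t < 0 the difference of the two sides, multiplied by e^t, is (e^t - 1)^2. *)
Lemma expR_sub1_le (R : realType) (t : R) : `|expR t - 1| <= expR `|t| - 1.
Proof.
have [t0|t0] := leP 0 t.
  by rewrite (ger0_norm t0) ger0_norm// subr_ge0 -expR0 ler_expR.
rewrite (ltr0_norm t0) ler0_norm; last by rewrite subr_le0 -expR0 ler_expR ltW.
rewrite opprB expRN; have e0 := expR_gt0 t.
rewrite -subr_ge0 -(pmulr_rge0 _ e0).
have -> : expR t * ((expR t)^-1 - 1 - (1 - expR t)) = (expR t - 1) ^+ 2.
  by field; rewrite gt_eqF.
exact: sqr_ge0.
Qed.

(** * Stationary moment estimates for fixed n *)

Section jsq_stationary.
Context (R : realType) (n : nat) (lambda mu eps : R).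
Hypothesis n_gt1 : (1 < n)%N.
Hypothesis mu_gt0 : 0 < mu.
Hypothesis eps_gt0 : 0 < eps.
Hypothesis eps_le : eps <= 2^-1.
Hypothesis n_eps_le1 : n%:R * eps <= 1.
Hypothesis lambdaE : lambda = n%:R * mu * (1 - eps).
Hypothesis decay :
  n%:R * (expR (160 / n%:R) + expR (- 160 / n%:R) - 2) + eps * 160
    - (1 - expR (- 160)) <= - 4^-1.
Variable (Pt : R -> jsq_state n -> jsq_state n -> R).
Hypothesis Pt_ctmc : ctmc_transition (jsq_generator lambda mu) Pt.
Context d (T : measurableType d) (P : probability T R) (V : T -> jsq_state n).
Hypothesis mV : forall x, measurable [set w | V w = x].
Hypothesis V_stat : stationary_distribution Pt (fun x => P [set w | V w = x]).
Implicit Types (x : jsq_state n) (F G : jsq_state n -> R).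

Local Notation integrable F := (P.-integrable [set: T] (fun w => (F (V w))%:E)).

Let n_gt0 : (0 < n)%N. Proof. exact: ltnW. Qed.
Let n0 : 0 < n%:R :> R. Proof. by rewrite ltr0n. Qed.
Let eps_ge0 : 0 <= eps. Proof. exact: ltW. Qed.
Let eps_le1 : eps <= 1.
Proof. by apply: le_trans eps_le _; rewrite invf_le1// ler1n. Qed.

Let lambda_ge0 : 0 <= lambda.
Proof. by rewrite lambdaE !mulr_ge0 ?subr_ge0// ltW. Qed.

Lemma jsq_drift_le f g h : (forall x, 0 <= f x) -> (forall x, 0 <= g x) ->
  (forall x, 0 <= h x) ->
  (forall x, jsq_step lambda mu f x - jsq_exit lambda mu x * f x <= h x - g x) ->
  (\int[P]_w (g (V w))%:E <= \int[P]_w (h (V w))%:E)%E.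
Proof.
apply: (stationary_drift_le (jsq_rate_ge0 lambda_ge0 mu_gt0)
  (esum_jsq_rate n_gt0 lambda_ge0 mu_gt0) (jsq_exit_le lambda mu_gt0)
  _ Pt_ctmc mV V_stat).
exact: esum_jsq_step.
Qed.

Lemma jsq_drift_eq0 f : (forall x, 0 <= f x) -> integrable f ->
  integrable (fun x => jsq_step lambda mu f x - jsq_exit lambda mu x * f x) /\
  \int[P]_w (jsq_step lambda mu f (V w) - jsq_exit lambda mu (V w) * f (V w)) = 0.
Proof.
apply: (stationary_drift_eq0 (jsq_rate_ge0 lambda_ge0 mu_gt0)
  (esum_jsq_rate n_gt0 lambda_ge0 mu_gt0) (jsq_exit_le lambda mu_gt0)
  _ Pt_ctmc mV V_stat).
exact: esum_jsq_step.
Qed.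

Let mF F : measurable_fun [set: T] (fun w => (F (V w))%:E).
Proof. by apply/measurable_EFinP; exact: (measurable_countable_comp mV). Qed.

Let le_integrable_law F G : integrable G -> (forall x, `|F x| <= G x) ->
  integrable F.
Proof.
move=> intG FG; apply: (le_integrable measurableT _ _ intG); first exact: mF.
move=> w _ /=; rewrite lee_fin (le_trans (FG _))// ler_norm//.
Qed.

Let ge0_integrable F : (forall x, 0 <= F x) ->
  (\int[P]_w (F (V w))%:E < +oo)%E -> integrable F.
Proof.
move=> F0 intF; apply/integrableP; split; first exact: mF.
rewrite (eq_integral (fun w => (F (V w))%:E))// => w _.
by rewrite gee0_abs// lee_fin.
Qed.

Let integrable_cst (c : R) : integrable (fun=> c).
Proof.
exact: finite_measure_integrable_cst.
Qed.

Lemma jsq_drift_le_fin f g h : (forall x, 0 <= f x) -> (forall x, 0 <= g x) ->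
  (forall x, 0 <= h x) -> integrable h ->
  (forall x, jsq_step lambda mu f x - jsq_exit lambda mu x * f x <= h x - g x) ->
  integrable g /\ \int[P]_w g (V w) <= \int[P]_w h (V w).
Proof.
move=> f0 g0 h0 inth drift; have gh := jsq_drift_le f0 g0 h0 drift.
have hfin : (\int[P]_w (h (V w))%:E)%E \is a fin_num by exact: integrable_fin_num.
have intg : integrable g.
  apply: ge0_integrable => //; apply: le_lt_trans gh _.
  by rewrite -ge0_fin_numE// integral_ge0// => w _; rewrite lee_fin.
by split=> //; apply: fine_le => //; exact: integrable_fin_num.
Qed.

Lemma exp_excess_moment : integrable (exp_excess 160) /\
  \int[P]_w exp_excess 160 (V w) <= 4 * expR 160 * n%:R.
Proof.
have mu4 : 0 < mu / 4 by rewrite divr_gt0.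
have [] := @jsq_drift_le_fin (exp_excess 160) (fun x => mu / 4 * exp_excess 160 x)
  (fun=> mu * n%:R * expR 160).
- by move=> x; exact: exp_excess_ge0.
- by move=> x; rewrite mulr_ge0 ?exp_excess_ge0// ltW.
- by move=> _; rewrite !mulr_ge0 ?expR_ge0// ltW.
- exact: integrable_cst.
- move=> x; apply: (drift_exp_excess_le n_gt0 mu_gt0 eps_ge0 eps_le1 lambdaE) => //.
move=> intW leW.
have intW' : integrable (exp_excess 160).
  have := integrableZl measurableT (mu / 4)^-1 intW.
  apply: eq_integrable => // w _; rewrite -EFinM mulrA mulVf ?mul1r//.
  by rewrite gt_eqF.
split=> //; move: leW; rewrite Rintegral_prob_cst RintegralZl//.
rewrite -ler_pdivlMl//; congr (_ <= _); field.
by rewrite gt_eqF.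
Qed.

(* 8 * (5 * 21 + 5 * (4 * expR 160)): collected from the drift of exp_excess (-1). *)
Definition gap_bound : R := 840 + 160 * expR 160.

Lemma exp_gap_moment : integrable (fun x => expR (queue_gap R x)) /\
  \int[P]_w expR (queue_gap R (V w)) <= gap_bound.
Proof.
have [intW leW] := exp_excess_moment.
have c0 : 0 < mu * n%:R / 8 by rewrite divr_gt0// mulr_gt0.
have mu0 := ltW mu_gt0.
have intW5 : integrable (fun x => mu * 5 * exp_excess 160 x).
  exact: (integrableZl measurableT (mu * 5) intW).
(* In [exp_deficit_le], 5 * n e^Y / 40 absorbs half of the drift - n e^Y / 4, so 1/8 remains; 105 is
   5 * 21. *)
have [] := @jsq_drift_le_fin (exp_excess (-1))
  (fun x => mu * n%:R / 8 * expR (queue_gap R x))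
  (fun x => mu * n%:R * 105 + mu * 5 * exp_excess 160 x).
- by move=> x; exact: exp_excess_ge0.
- by move=> x; rewrite mulr_ge0 ?expR_ge0// ltW.
- by move=> x; rewrite addr_ge0// !mulr_ge0// exp_excess_ge0.
- exact: (integrableD measurableT (integrable_cst _) intW5).
- move=> x; apply: le_trans
    (drift_exp_deficit_le n_gt0 mu_gt0 eps_ge0 eps_le1 lambdaE x n_gt1 eps_le) _.
  have := ler_wpM2l mu0 (exp_deficit_le R n_gt0 x).
  lra.
move=> intg leg.
have intY : integrable (fun x => expR (queue_gap R x)).
  have := integrableZl measurableT (mu * n%:R / 8)^-1 intg.
  apply: eq_integrable => // w _; rewrite -EFinM mulrA mulVf ?mul1r//.
  by rewrite gt_eqF.
split=> //; move: leg; rewrite RintegralZl// RintegralD//; last exact: integrable_cst.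
rewrite Rintegral_prob_cst RintegralZl// => leg.
rewrite -(ler_pM2l c0); apply: le_trans leg _.
have := ler_wpM2l mu0 leW; rewrite /gap_bound; lra.
Qed.

Definition idle x : R := n%:R - (busy x)%:R.

Lemma idle_ge0 x : 0 <= idle x.
Proof. by rewrite subr_ge0 ler_nat busy_le. Qed.

Lemma idle_le x : idle x <= n%:R.
Proof. by rewrite gerBl. Qed.

Lemma idle_total x : idle x != 0 -> (total x)%:R = n%:R * queue_gap R x.
Proof.
rewrite /idle subr_eq0 eqr_nat eq_sym => bx.
have {bx}/(shortest_idle n_gt0) sx : (busy x < n)%N by rewrite ltn_neqAle bx busy_le.
by rewrite /queue_gap sx subr0 /mean_queue mulrCA divff ?mulr1// gt_eqF.
Qed.

(** The factor [mu * (1 - expR (- s))] vanishes only at [s = 0]; for other [s], zero mean drift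
    therefore yields an identity free of it. *)
Lemma drift_exp_total s x :
  jsq_step lambda mu (fun y => expR (s * (total y)%:R)) x
    - jsq_exit lambda mu x * expR (s * (total x)%:R) =
  mu * (1 - expR (- s)) *
    ((idle x - n%:R * (1 - (1 - eps) * expR s)) * expR (s * (total x)%:R)).
Proof.
rewrite jsq_step_exp// /jsq_exit /idle lambdaE expRN.
by field; rewrite gt_eqF// expR_gt0.
Qed.

Lemma idle_exp_le s x : `|s| * n%:R <= 1 ->
  idle x * expR (s * (total x)%:R) <= n%:R * expR (queue_gap R x).
Proof.
move=> s1; have [->|ix] := eqVneq (idle x) 0.
  by rewrite mul0r mulr_ge0// expR_ge0.
rewrite ler_pM ?idle_ge0 ?expR_ge0 ?idle_le// ler_expR idle_total// mulrA.
rewrite -[leRHS]mul1r ler_wpM2r ?queue_gap_ge0//; apply: le_trans s1.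
by rewrite ler_wpM2r// ler_norm.
Qed.

(** For s > 0 the function is its own Lyapunov function: its drift is negative except for the idle
    term, which the exponential gap moment dominates. For s <= 0 it is bounded by 1. *)
Lemma integrable_exp_total s : (1 - eps) * expR s < 1 -> `|s| * n%:R <= 1 ->
  integrable (fun x => expR (s * (total x)%:R)).
Proof.
move=> s_sub s1; have [s0|s0] := leP s 0.
  apply: (le_integrable_law (F := fun x => expR (s * (total x)%:R))
    (G := fun=> 1) (integrable_cst 1)) => x.
  by rewrite ger0_norm ?expR_ge0// -expR0 ler_expR mulr_le0_ge0.
pose k := mu * (1 - expR (- s)).
have k0 : 0 < k by rewrite mulr_gt0// subr_gt0 -expR0 ltr_expR oppr_lt0.
pose D := n%:R * (1 - (1 - eps) * expR s).
have D0 : 0 < D by rewrite mulr_gt0// subr_gt0.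
have [] := @jsq_drift_le_fin (fun x => expR (s * (total x)%:R))
  (fun x => k * D * expR (s * (total x)%:R))
  (fun x => k * (n%:R * expR (queue_gap R x))).
- by move=> x; exact: expR_ge0.
- by move=> x; apply: mulr_ge0 (expR_ge0 _); apply: mulr_ge0; exact: ltW.
- by move=> x; apply: mulr_ge0 (ltW k0) _; rewrite mulr_ge0// expR_ge0.
- have [intY _] := exp_gap_moment.
  have := integrableZl measurableT (k * n%:R) intY.
  by apply: eq_integrable => // w _; rewrite -EFinM mulrA.
- move=> x; rewrite drift_exp_total -/k -/D.
  by have := ler_wpM2l (ltW k0) (idle_exp_le x s1); lra.
move=> intg _; have kD0 : k * D != 0 by rewrite gt_eqF// mulr_gt0.
have := integrableZl measurableT (k * D)^-1 intg.
by apply: eq_integrable => // w _; rewrite -EFinM mulrA mulVf ?mul1r.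
Qed.

Lemma integrable_idle_exp s : `|s| * n%:R <= 1 ->
  integrable (fun x => idle x * expR (s * (total x)%:R)).
Proof.
move=> s1; have [intY _] := exp_gap_moment.
have intnY : integrable (fun x => n%:R * expR (queue_gap R x)).
  exact: (integrableZl measurableT n%:R intY).
apply: (le_integrable_law (F := fun x => idle x * expR (s * (total x)%:R))
  (G := fun x => n%:R * expR (queue_gap R x)) intnY) => x.
by rewrite ger0_norm ?mulr_ge0 ?idle_ge0 ?expR_ge0//; exact: idle_exp_le.
Qed.

Lemma idle_exp_mean s : s != 0 -> (1 - eps) * expR s < 1 -> `|s| * n%:R <= 1 ->
  \int[P]_w (idle (V w) * expR (s * (total (V w))%:R)) =
  n%:R * (1 - (1 - eps) * expR s) * \int[P]_w expR (s * (total (V w))%:R).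
Proof.
move=> sn0 s_sub s1; have intE := integrable_exp_total s_sub s1.
have intI := integrable_idle_exp s1.
have [_] := jsq_drift_eq0 (fun x => expR_ge0 (s * (total x)%:R)) intE.
under eq_Rintegral do rewrite drift_exp_total.
set D := n%:R * _.
have intDE : integrable (fun x => D * expR (s * (total x)%:R)).
  exact: (integrableZl measurableT D intE).
have intB : integrable (fun x => (idle x - D) * expR (s * (total x)%:R)).
  have := integrableB measurableT intI intDE.
  by apply: eq_integrable => // w _; rewrite (mulrBl _ (idle _) D) EFinB.
rewrite RintegralZl//.
under eq_Rintegral do rewrite (mulrBl _ (idle _) D).
rewrite RintegralB// RintegralZl// => /eqP.
rewrite mulf_eq0 mulf_eq0 (gt_eqF mu_gt0)/= subr_eq0.
have -> /= : (1 == expR (- s)) = false.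
  by rewrite -expR0 eq_sym (inj_eq (@expR_inj R)) oppr_eq0; exact/negbTE.
by rewrite subr_eq0 => /eqP.
Qed.

(** Zero mean drift of [total]. Its integrability comes from the exponential moment at the
    subcritical exponent [eps / 2]. *)
Lemma idle_mean : \int[P]_w idle (V w) = n%:R * eps.
Proof.
have s_sub : (1 - eps) * expR (eps / 2) < 1.
  have : (1 - eps) * expR (eps / 2) <= expR (- (eps / 2)).
    have -> : - (eps / 2) = - eps + eps / 2 by lra.
    by rewrite expRD ler_wpM2r ?expR_ge0// expR_ge1Dx.
  by move=> /le_lt_trans; apply; rewrite -expR0 ltr_expR oppr_lt0 divr_gt0.
have s1 : `|eps / 2| * n%:R <= 1.
  by rewrite ger0_norm ?divr_ge0//; have := n_eps_le1; have := n0; nra.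
have intE := integrable_exp_total s_sub s1.
have intS : integrable (fun x => (total x)%:R).
  have intE' : integrable (fun x => (eps / 2)^-1 * expR (eps / 2 * (total x)%:R)).
    exact: (integrableZl measurableT (eps / 2)^-1 intE).
  apply: (le_integrable_law (F := fun x => (total x)%:R)
    (G := fun x => (eps / 2)^-1 * expR (eps / 2 * (total x)%:R)) intE') => x; rewrite ger0_norm//.
  rewrite ler_pdivlMl ?divr_gt0//.
  by apply: le_trans (expR_ge1Dx _); rewrite lerDr.
have [] := jsq_drift_eq0 (fun x => ler0n R (total x)) intS.
have driftS x : jsq_step lambda mu (fun y => (total y)%:R) x
    - jsq_exit lambda mu x * (total x)%:R = mu * (idle x - n%:R * eps).
  by rewrite jsq_step_total// /jsq_exit /idle lambdaE; ring.
move=> _; under eq_Rintegral do rewrite driftS.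
have intI : integrable idle.
  apply: (le_integrable_law (F := idle) (G := fun=> n%:R) (integrable_cst n%:R)) => x.
  by rewrite ger0_norm ?idle_ge0 ?idle_le.
have intIB : integrable (fun x => idle x - n%:R * eps).
  exact: (integrableB measurableT intI (integrable_cst (n%:R * eps))).
rewrite RintegralZl// RintegralB//; last exact: integrable_cst.
rewrite Rintegral_prob_cst => /eqP.
by rewrite mulf_eq0 (gt_eqF mu_gt0)/= subr_eq0 => /eqP.
Qed.

Lemma gap_bound_ge0 : 0 <= gap_bound.
Proof. by rewrite /gap_bound; have := expR_ge0 (160 : R); lra. Qed.

(* On the event that some server idles, total = n * gap, so that the exponential
   is close to 1 unless the gap exceeds K. *)
Lemma exp_total_moment s K : (1 - eps) * expR s < 1 -> `|s| * n%:R <= 2^-1 ->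
  0 <= K ->
  `|n%:R * (1 - (1 - eps) * expR s) * \int[P]_w expR (s * (total (V w))%:R)
    - n%:R * eps| <=
  (expR (`|s| * n%:R * K) - 1) * (n%:R * eps) + n%:R * expR (- K / 2) * gap_bound.
Proof.
move=> s_sub s2 K0.
have s1 : `|s| * n%:R <= 1 by lra.
have [s_eq0|sn0] := eqVneq s 0.
  rewrite s_eq0 normr0 !mul0r expR0 subrr mul0r add0r mulr1 opprB addrCA subrr addr0.
  under eq_Rintegral do rewrite mul0r expR0.
  rewrite Rintegral_prob_cst mulr1 subrr normr0.
  apply: mulr_ge0; last exact: gap_bound_ge0.
  by rewrite mulr_ge0// expR_ge0.
rewrite -idle_exp_mean// -idle_mean.
have intI : integrable idle.
  apply: (le_integrable_law (F := idle) (G := fun=> n%:R) (integrable_cst n%:R)) => x.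
  by rewrite ger0_norm ?idle_ge0 ?idle_le.
have intIE := integrable_idle_exp s1.
have [intY leY] := exp_gap_moment.
set a := expR _ - 1; set b := n%:R * expR _.
have a0 : 0 <= a.
  by rewrite subr_ge0 -expR0 ler_expR mulr_ge0.
have b0 : 0 <= b by rewrite mulr_ge0// expR_ge0.
have intaI : integrable (fun x => a * idle x).
  exact: (integrableZl measurableT a intI).
have intbY : integrable (fun x => b * expR (queue_gap R x)).
  exact: (integrableZl measurableT b intY).
have intR : integrable (fun x => a * idle x + b * expR (queue_gap R x)).
  exact: (integrableD measurableT intaI intbY).
have intL : integrable (fun x => idle x * expR (s * (total x)%:R) - idle x).
  exact: (integrableB measurableT intIE intI).
rewrite -RintegralB//.
apply: le_trans (le_normr_Rintegral measurableT intL) _.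
apply: (@le_trans _ _ (\int[P]_w (a * idle (V w) + b * expR (queue_gap R (V w))))).
  apply: le_Rintegral => //.
    exact: (integrable_abse intL).
  move=> w _; set x := V w.
  have -> : idle x * expR (s * (total x)%:R) - idle x =
    idle x * (expR (s * (total x)%:R) - 1) by ring.
  rewrite normrM ger0_norm ?idle_ge0//.
  have [->|ix] := eqVneq (idle x) 0.
    by rewrite mul0r mulr0 add0r mulr_ge0// expR_ge0.
  rewrite idle_total//; set Y := queue_gap R x.
  have Y0 : 0 <= Y := queue_gap_ge0 R n_gt0 x.
  apply: (@le_trans _ _ (idle x * (expR (`|s| * n%:R * Y) - 1))).
    rewrite ler_wpM2l ?idle_ge0// (le_trans (expR_sub1_le _))//.
    by rewrite normrM (ger0_norm (mulr_ge0 (ltW n0) Y0)) mulrA.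
  have [YK|KY] := leP Y K.
    apply: (@le_trans _ _ (a * idle x)).
      by rewrite mulrC ler_wpM2r ?idle_ge0// lerD2r ler_expR ler_wpM2l//.
    by rewrite lerDl mulr_ge0// expR_ge0.
  apply: (@le_trans _ _ (b * expR Y)); last first.
    by rewrite lerDr mulr_ge0// idle_ge0.
  rewrite /b -(mulrA n%:R) -expRD; apply: ler_pM.
  - exact: idle_ge0.
  - by rewrite subr_ge0 -expR0 ler_expR !mulr_ge0.
  - exact: idle_le.
  apply: (@le_trans _ _ (expR (`|s| * n%:R * Y))); first by rewrite gerBl.
  rewrite ler_expR; have := ler_wpM2r Y0 s2; lra.
rewrite RintegralD// !RintegralZl// lerD2l ler_wpM2l//.
Qed.

End jsq_stationary.

(** * Heavy-traffic asymptotics *)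

Section powR_asymptotics.
Context (R : realType).
Implicit Types (a b c t : R).

Lemma cvg_powRN b : 0 < b -> n%:R `^ (- b) @[n --> \oo] --> (0 : R).
Proof.
move=> b0; apply/cvgrPdist_lt => e e0; near=> n.
have ei0 : 0 < e^-1 by rewrite invr_gt0.
have n0 : 0 < n%:R :> R.
  by apply: lt_trans (_ : e^-1 `^ b^-1 < _); [exact: powR_gt0|near: n; exact: nbhs_infty_gtr].
rewrite sub0r normrN ger0_norm ?powR_ge0// powRN -[e]invrK ltf_pV2 ?posrE ?powR_gt0//.
have -> : e^-1 = (e^-1 `^ b^-1) `^ b by rewrite -powRrM mulVf ?powRr1 ?ltW// gt_eqF.
apply: gt0_ltr_powR; rewrite ?nnegrE ?powR_ge0 ?ltW//.
by near: n; exact: nbhs_infty_gtr.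
Unshelve. all: by end_near. Qed.

(** With y = c n^b, raise e^(y/k) >= y/k to the power [k]. *)
Lemma powR_expRN_le a b c (k n : nat) : 0 < c -> (0 < n)%N -> (0 < k)%N ->
  n%:R `^ a * expR (- (c * n%:R `^ b)) <= (k%:R / c) ^+ k * n%:R `^ (a - b * k%:R).
Proof.
move=> c0 n0 k0; set x := n%:R `^ b.
have nR : n%:R != 0 :> R by rewrite pnatr_eq0 -lt0n.
have kR : 0 < k%:R :> R by rewrite ltr0n.
have x0 : 0 < x by rewrite powR_gt0// ltr0n.
rewrite powRB ?nR ?implybT// powRrM powR_mulrn ?powR_ge0// -/x.
rewrite mulrCA ler_wpM2l ?powR_ge0//.
have -> : (k%:R / c) ^+ k / x ^+ k = ((c * x / k%:R) ^+ k)^-1.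
  by rewrite -expr_div_n -exprVn; congr (_ ^+ k); field; rewrite !gt_eqF.
rewrite expRN lef_pV2 ?posrE ?expR_gt0//; last first.
  by rewrite exprn_gt0// divr_gt0// mulr_gt0.
have -> : expR (c * x) = expR (c * x / k%:R) ^+ k.
  by rewrite -expRM_natl; congr expR; field; rewrite gt_eqF.
rewrite lerXn2r ?nnegrE ?expR_ge0//.
  by rewrite divr_ge0 ?mulr_ge0// ltW.
by apply: le_trans (expR_ge1Dx _); rewrite lerDr.
Qed.

Lemma cvg_powR_expRN a b c : 0 < b -> 0 < c ->
  n%:R `^ a * expR (- (c * n%:R `^ b)) @[n --> \oo] --> (0 : R).
Proof.
move=> b0 c0; near \oo => k.
have k0 : (0 < k)%N by near: k; exact: nbhs_infty_gt.
have abk : a < b * k%:R.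
  by rewrite -ltr_pdivrMl//; near: k; exact: nbhs_infty_gtr.
apply: (@squeeze_cvgr _ _ _ _ (fun=> 0)
  (fun n => (k%:R / c) ^+ k * n%:R `^ (- (b * k%:R - a)))).
- near=> n; rewrite mulr_ge0 ?powR_ge0 ?expR_ge0//= opprB powR_expRN_le//.
  by near: n; exact: nbhs_infty_gt.
- exact: cvg_cst.
- rewrite -[X in _ --> X](mulr0 ((k%:R / c) ^+ k)); apply: cvgM; first exact: cvg_cst.
  by apply: cvg_powRN; rewrite subr_gt0.
Unshelve. all: by end_near. Qed.

(** From (1 - t) e^t <= 1: the remainder is at most t^2 / (1 - t), and 1 - t >= 1/2. *)
Lemma expR_sub1D_le t : t <= 2^-1 -> `|expR t - 1 - t| <= 2 * t ^+ 2.
Proof.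
move=> t2; have e1 := expR_ge1Dx t; have e2 := expR_ge1Dx (- t).
rewrite ger0_norm; last by lra.
rewrite expRN in e2; have e0 := expR_gt0 t.
have {}e2 : (1 - t) * expR t <= 1.
  by rewrite -(ler_pM2r e0) mulVf ?gt_eqF// in e2.
nra.
Qed.

Lemma expR_sum2_le t : `|t| <= 2^-1 -> expR t + expR (- t) - 2 <= 4 * t ^+ 2.
Proof.
rewrite ler_norml => /andP[t1 t2].
have := expR_sub1D_le t2; have : `|expR (- t) - 1 - - t| <= 2 * (- t) ^+ 2.
  by apply: expR_sub1D_le; lra.
by rewrite !ler_norml sqrrN => /andP[_ ?] /andP[_ ?]; lra.
Qed.

End powR_asymptotics.

Section heavy_traffic_limits.
Context (R : realType).
Implicit Types (alpha theta C : R).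

Local Notation eps alpha n := (n%:R `^ (- alpha)).

Lemma cvg_normalized_drift alpha theta : 0 < alpha ->
  (1 - (1 - eps alpha n) * expR (theta * eps alpha n)) / eps alpha n
    @[n --> \oo] --> (1 - theta : R).
Proof.
move=> alpha0; have eps0 := cvg_powRN alpha0.
have teps0 : theta * eps alpha n @[n --> \oo] --> (0 : R).
  by rewrite -[X in _ --> X](mulr0 theta); apply: cvgM => //; exact: cvg_cst.
have expt : expR (theta * eps alpha n) @[n --> \oo] --> (1 : R).
  rewrite -[X in _ --> X](@expR0 R).
  by apply: continuous_cvg => //; exact: continuous_expR.
have slope : (expR (theta * eps alpha n) - 1) / eps alpha n - theta
    @[n --> \oo] --> (0 : R).
  apply/norm_cvg0P.
  apply: (@squeeze_cvgr _ _ _ _ (fun=> 0) (fun n => 2 * theta ^+ 2 * eps alpha n)).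
  - near=> n; rewrite normr_ge0/=.
    have e0 : 0 < eps alpha n :> R.
      by rewrite powR_gt0// ltr0n; near: n; exact: nbhs_infty_gt.
    have t2 : theta * eps alpha n <= 2^-1.
      near: n; apply: (cvgr_le _ teps0).
      by rewrite invr_gt0.
    have := expR_sub1D_le t2.
    have -> : (expR (theta * eps alpha n) - 1) / eps alpha n - theta =
      (expR (theta * eps alpha n) - 1 - theta * eps alpha n) / eps alpha n.
      by field; rewrite gt_eqF.
    rewrite normrM (gtr0_norm (_ : 0 < (eps alpha n)^-1)) ?invr_gt0//.
    rewrite ler_pdivrMr// => /le_trans; apply.
    by rewrite le_eqVlt; apply/orP; left; apply/eqP; ring.
  - exact: cvg_cst.
  - rewrite -[X in _ --> X](mulr0 (2 * theta ^+ 2)).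
    by apply: cvgM => //; exact: cvg_cst.
have : expR (theta * eps alpha n) -
    ((expR (theta * eps alpha n) - 1) / eps alpha n - theta) - theta
    @[n --> \oo] --> 1 - 0 - theta.
  by apply: cvgB; [exact: cvgB|exact: cvg_cst].
rewrite subr0; apply: cvg_trans; apply: near_eq_cvg; near=> n.
have e0 : 0 < eps alpha n :> R.
  by rewrite powR_gt0// ltr0n; near: n; exact: nbhs_infty_gt.
by field; rewrite gt_eqF.
Unshelve. all: by end_near. Qed.

Lemma cvg_mgf_of_bound alpha theta C (M : nat -> R) : 1 < alpha -> theta < 1 ->
  (\forall n \near \oo, forall K, 0 <= K ->
    `|n%:R * (1 - (1 - eps alpha n) * expR (theta * eps alpha n)) * M n
      - n%:R * eps alpha n| <=
    (expR (`|theta * eps alpha n| * n%:R * K) - 1) * (n%:R * eps alpha n)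
      + n%:R * expR (- K / 2) * C) ->
  M n @[n --> \oo] --> (1 - theta)^-1.
Proof.
move=> alpha1 theta1 bound.
have alpha0 : 0 < alpha by apply: lt_trans alpha1.
(* The cutoff will be K = n^beta. After division by n eps = n^(1 - alpha), the two errors are
   governed by n eps K = n^(- beta) and n^alpha e^(- K/2); both tend to 0. *)
pose beta := (alpha - 1) / 2.
have beta0 : 0 < beta by rewrite divr_gt0// subr_gt0.
have := @cvg_normalized_drift _ theta alpha0.
set a := (fun n : nat => _ / _) => cvga.
have a_neq0 : \forall n \near \oo, a n != 0.
  by apply: (cvgr_neq0 _ cvga); rewrite subr_eq0 gt_eqF.
have cvgaM : a n * M n @[n --> \oo] --> (1 : R).
  apply/subr_cvg0/norm_cvg0P.
  apply: (@squeeze_cvgr _ _ _ _ (fun=> 0) (fun n =>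
    (expR (`|theta| * n%:R `^ (- beta)) - 1)
    + n%:R `^ alpha * expR (- (2^-1 * n%:R `^ beta)) * C)).
  - near=> n; rewrite normr_ge0/=.
    have n0 : 0 < n%:R :> R by rewrite ltr0n; near: n; exact: nbhs_infty_gt.
    have e0 : 0 < eps alpha n :> R by rewrite powR_gt0.
    have bn : (forall K, 0 <= K ->
    `|n%:R * (1 - (1 - eps alpha n) * expR (theta * eps alpha n)) * M n
      - n%:R * eps alpha n| <=
    (expR (`|theta * eps alpha n| * n%:R * K) - 1) * (n%:R * eps alpha n)
      + n%:R * expR (- K / 2) * C) by near: n; exact: bound.
    have := bn (n%:R `^ beta) (powR_ge0 _ _).
    have -> : `|theta * eps alpha n| * n%:R * n%:R `^ beta =
        `|theta| * n%:R `^ (- beta).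
      rewrite normrM (gtr0_norm e0) -!mulrA; congr (_ * _).
      have pD r s : n%:R `^ r * n%:R `^ s = n%:R `^ (r + s) :> R.
        by rewrite powRD// (gt_eqF n0) implybT.
      rewrite -[X in _ * (X * _)]powRr1 ?(ltW n0)// !pD; congr (_ `^ _).
      by rewrite /beta; field.
    have -> : n%:R * (1 - (1 - eps alpha n) * expR (theta * eps alpha n)) * M n
        - n%:R * eps alpha n = (n%:R * eps alpha n) * (a n * M n - 1).
      by rewrite /a; field; rewrite gt_eqF.
    rewrite normrM gtr0_norm ?mulr_gt0//.
    have -> : n%:R * expR (- n%:R `^ beta / 2) * C = (n%:R * eps alpha n) *
        (n%:R `^ alpha * expR (- (2^-1 * n%:R `^ beta)) * C).
      rewrite powRN mulNr (mulrC (n%:R `^ beta)).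
      by field; rewrite gt_eqF// powR_gt0.
    by rewrite (mulrC _ (n%:R * eps alpha n)) -mulrDr ler_pM2l// mulr_gt0.
  - exact: cvg_cst.
  - rewrite -[X in _ --> X]addr0 -[X in X + _](subrr (1 : R)) -[X in _ + X](mul0r C).
    apply: cvgD; last by apply: cvgM; [apply: cvg_powR_expRN; rewrite ?invr_gt0|exact: cvg_cst].
    apply: cvgB; last exact: cvg_cst.
    rewrite -[X in _ --> X](@expR0 R); apply: continuous_cvg.
      exact: continuous_expR.
    rewrite -[X in _ --> X](mulr0 `|theta|).
    by apply: cvgM; [exact: cvg_cst|exact: cvg_powRN].
have : a n * M n / a n @[n --> \oo] --> 1 / (1 - theta).
  by apply: cvgM => //; apply: cvgV => //; rewrite subr_eq0 gt_eqF.
rewrite mul1r; apply: cvg_trans; apply: near_eq_cvg; near=> n.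
by rewrite mulrAC divff ?mul1r//; near: n.
Unshelve. all: by end_near. Qed.

(** For large n the three terms are at most 1/16, 1/16 and -1/2; the first is even in 160/n, hence
    of order 1/n. *)
Lemma near_excess_decay alpha : 0 < alpha ->
  \forall n \near \oo, n%:R * (expR (160 / n%:R) + expR (- 160 / n%:R) - 2)
    + n%:R `^ (- alpha) * 160 - (1 - expR (- 160)) <= - 4^-1 :> R.
Proof.
move=> alpha0; have eps0 := cvg_powRN alpha0.
pose c : R := 160; rewrite -/c.
have c0 : 0 < c by rewrite /c.
have c2 : 2 <= c by rewrite /c ler_nat.
have ic : expR (- c) <= 2^-1.
  rewrite expRN lef_pV2 ?posrE ?expR_gt0//.
  by apply: le_trans (expR_ge1Dx _); lra.
near=> n.
have nc : c * c * 64 < n%:R by near: n; exact: nbhs_infty_gtr.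
have n0 : 0 < n%:R :> R by apply: lt_trans nc; rewrite !mulr_gt0.
have ec : n%:R `^ (- alpha) * c <= 16^-1.
  rewrite -ler_pdivlMr//; near: n; apply: (cvgr_le _ eps0).
  by rewrite divr_gt0// invr_gt0.
have small : `|c / n%:R| <= 2^-1.
  rewrite ger0_norm; last by rewrite divr_ge0// ltW.
  rewrite ler_pdivrMr//; nra.
have := expR_sum2_le small; rewrite -mulNr => /(ler_wpM2l (ltW n0)).
have -> : n%:R * (4 * (c / n%:R) ^+ 2) = 4 * (c * c) / n%:R.
  by field; rewrite gt_eqF.
have : 4 * (c * c) / n%:R <= 16^-1 by rewrite ler_pdivrMr//; lra.
lra.
Unshelve. all: by end_near. Qed.

End heavy_traffic_limits.

(** * Convergence in law *)

Section bernstein.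
Context (R : realType).
Implicit Types (f g : nat -> R) (N k : nat) (u v : R).

(* bernstein f N is the polynomial u |-> E[f(B)] with B binomial (N, u),
   computed by conditioning on the first trial. *)
Fixpoint bernstein f N : {poly R} :=
  if N is N'.+1
  then 'X * bernstein (fun k => f k.+1) N' + (1 - 'X) * bernstein f N'
  else (f 0%N)%:P.

Lemma bernstein0E f u : (bernstein f 0).[u] = f 0%N.
Proof. by rewrite /= hornerC. Qed.

Lemma bernsteinSE f N u : (bernstein f N.+1).[u] =
  u * (bernstein (fun k => f k.+1) N).[u] + (1 - u) * (bernstein f N).[u].
Proof. by rewrite /= !hornerE. Qed.

Lemma le_bernstein f g N u : 0 <= u <= 1 ->
  (forall k, (k <= N)%N -> f k <= g k) ->
  (bernstein f N).[u] <= (bernstein g N).[u].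
Proof.
move=> /andP[u0 u1]; elim: N f g => [|N IH] f g fg.
  by rewrite !bernstein0E fg.
rewrite !bernsteinSE lerD// ler_wpM2l ?subr_ge0//; apply: IH => k kN.
  exact: fg.
by apply: fg; rewrite (leq_trans kN).
Qed.

Lemma bernsteinD f g N u : (bernstein (fun k => f k + g k) N).[u] =
  (bernstein f N).[u] + (bernstein g N).[u].
Proof.
elim: N f g => [|N IH] f g; first by rewrite !bernstein0E.
by rewrite !bernsteinSE !IH; ring.
Qed.

Lemma bernsteinZ (c : R) f N u : (bernstein (fun k => c * f k) N).[u] =
  c * (bernstein f N).[u].
Proof.
elim: N f => [|N IH] f; first by rewrite !bernstein0E.
by rewrite !bernsteinSE !IH; ring.
Qed.

Lemma bernstein_cst (c : R) N u : (bernstein (fun=> c) N).[u] = c.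
Proof.
elim: N => [|N IH]; first by rewrite bernstein0E.
by rewrite bernsteinSE IH; ring.
Qed.

(** Squared bias plus the variance of a binomial variable. A free [a] lets the induction use both
    [a] and [a - 1]. *)
Lemma bernstein_sqr (a : R) N u :
  (bernstein (fun k => (k%:R - a) ^+ 2) N).[u] =
  (N%:R * u - a) ^+ 2 + N%:R * (u * (1 - u)).
Proof.
elim: N a => [|N IH] a; first by rewrite bernstein0E !mul0r addr0.
rewrite bernsteinSE (_ : (fun k => (k.+1%:R - a) ^+ 2) =
  (fun k => (k%:R - (a - 1)) ^+ 2)).
  by rewrite !IH -[in RHS]natr1; ring.
by apply/funext => k; rewrite -natr1; congr (_ ^+ 2); ring.
Qed.

Lemma weierstrass_approximation (h : R -> R) (M : R) :
  (forall u, `|h u| <= M) ->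
  (forall e, 0 < e -> exists2 delta, 0 < delta &
    forall u v, 0 <= u <= 1 -> 0 <= v <= 1 -> `|v - u| <= delta ->
      `|h v - h u| <= e) ->
  forall e, 0 < e ->
  exists p : {poly R}, forall u, 0 <= u <= 1 -> `|h u - p.[u]| <= e.
Proof.
move=> hM hunif e e0.
have e20 : 0 < e / 2 by rewrite divr_gt0.
have [delta delta0 hdelta] := hunif _ e20.
have M0 : 0 <= M by apply: le_trans (hM 0).
near \oo => N.
have N0 : (0 < N)%N by near: N; exact: nbhs_infty_gt.
have NR : 0 < N%:R :> R by rewrite ltr0n.
have NM : 2 * M / delta ^+ 2 / (e / 2) < N%:R.
  by near: N; exact: nbhs_infty_gtr.
exists (bernstein (fun k => h (k%:R / N%:R)) N) => u u01.
(* Chebyshev's argument: if k/N is farther than [delta] from u, then D (k - N u)^2 exceeds 2 M, the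
   largest possible difference of two values of [h]. *)
pose D := 2 * M / (delta * N%:R) ^+ 2.
have dN0 : 0 < delta * N%:R by rewrite mulr_gt0.
have D0 : 0 <= D by apply: divr_ge0; [exact: mulr_ge0|exact: sqr_ge0].
have pointwise k : (k <= N)%N ->
    `|h (k%:R / N%:R) - h u| <= e / 2 + D * (k%:R - N%:R * u) ^+ 2.
  move=> kN; have k01 : 0 <= (k%:R / N%:R : R) <= 1.
    by rewrite divr_ge0//= ler_pdivrMr// mul1r ler_nat.
  have [close|far] := leP `|k%:R / N%:R - u| delta.
    have := hdelta _ _ u01 k01 close => /le_trans; apply.
    by rewrite lerDl mulr_ge0// sqr_ge0.
  apply: (@le_trans _ _ (2 * M)).
    rewrite (le_trans (ler_normB _ _))//; have := hM u; have := hM (k%:R / N%:R); lra.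
  apply: (@le_trans _ _ (D * (k%:R - N%:R * u) ^+ 2)); last by rewrite lerDr ltW.
  rewrite /D mulrAC ler_pdivlMr ?exprn_gt0// ler_wpM2l ?mulr_ge0//.
  have -> : k%:R - N%:R * u = (k%:R / N%:R - u) * N%:R.
    by rewrite mulrBl divfK ?gt_eqF// mulrC.
  rewrite -[leRHS]real_normK ?num_real// lerXn2r ?nnegrE ?normr_ge0// ?(ltW dN0)//.
  by rewrite normrM (gtr0_norm NR) ler_pM2r// ltW.
have DN : D * (N%:R * (u * (1 - u))) <= e / 2.
  have uu : u * (1 - u) <= 1 by case/andP: u01 => ? ?; nra.
  apply: (@le_trans _ _ (D * N%:R)).
    by rewrite ler_wpM2l// ler_piMr// ltW.
  have -> : D * N%:R = 2 * M / delta ^+ 2 / N%:R.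
    by rewrite /D; field; rewrite !gt_eqF.
  by rewrite ler_pdivrMr// [leRHS]mulrC -ler_pdivrMr// ltW.
have mean_bound : (bernstein (fun k => e / 2 + D * (k%:R - N%:R * u) ^+ 2) N).[u] <= e.
  rewrite bernsteinD bernstein_cst bernsteinZ bernstein_sqr subrr expr0n add0r.
  by have := DN; lra.
have hB : (bernstein (fun k => h (k%:R / N%:R) - h u) N).[u] =
    (bernstein (fun k => h (k%:R / N%:R)) N).[u] - h u.
  by rewrite bernsteinD bernstein_cst.
rewrite distrC -hB ler_norml; apply/andP; split; last first.
  apply: le_trans mean_bound; apply: le_bernstein => // k kN.
  exact: le_trans (ler_norm _) (pointwise k kN).
rewrite lerNl; apply: le_trans mean_bound.
rewrite -mulN1r -bernsteinZ; apply: le_bernstein => // k kN.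
by rewrite mulN1r (le_trans _ (pointwise k kN))// -normrN ler_norm.
Unshelve. all: by end_near. Qed.

End bernstein.

(** * Continuous functions on the sequence space near the diagonal *)

Section sequence_space.
Context (R : realType).

Lemma cvg_ptws (U : Type) (F : set_system U) (FF : Filter F)
  (y : U -> {ptws nat -> R}) (c : {ptws nat -> R}) :
  (forall i, y k i @[k --> F] --> c i) -> y @ F --> c.
Proof.
move=> yc; apply/cvg_sup => i B [V] [[W] oW <-] Wc WB.
apply: (filterS WB); apply: yc.
by apply: open_nbhs_nbhs; split.
Qed.

Lemma continuous_diagonal (f : {ptws nat -> R} -> R) : continuous f ->
  continuous (fun t => f (fun=> t)).
Proof.
move=> cf t; apply: (@cvg_comp _ _ _ (fun t => (fun=> t) : {ptws nat -> R}) f);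
  last exact: cf.
by apply: (@cvg_ptws _ _ _ (fun t => fun=> t) (fun=> t)) => i; exact: cvg_id.
Qed.

(* Bolzano-Weierstrass in the parameter t makes the modulus uniform. *)
Lemma continuous_near_diagonal (f : {ptws nat -> R} -> R) (K e : R) :
  continuous f -> 0 < e -> exists k : nat, forall t (y : {ptws nat -> R}),
    0 <= t <= K -> (forall i, (i < k)%N -> `|y i - t| <= k.+1%:R^-1) ->
    `|f y - f (fun=> t)| <= e.
Proof.
move=> cf e0; apply: contrapT => /forallNP nk.
have /choice[ty tyP] : forall k : nat, exists ty : R * {ptws nat -> R},
    [/\ 0 <= ty.1 <= K,
      forall i, (i < k)%N -> `|ty.2 i - ty.1| <= k.+1%:R^-1 &
      e < `|f ty.2 - f (fun=> ty.1)|].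
  move=> k; have /existsNP[t /existsNP[y]] := nk k.
  move=> /not_implyP[tK /not_implyP[yt /negP]].
  by rewrite -ltNge => fe; exists (t, y).
pose t k := (ty k).1; pose y k := (ty k).2.
have bt : bounded_fun t.
  exists K; split; first exact: num_real.
  move=> M KM k _ /=; have [/andP[t0 tK] _ _] := tyP k.
  by rewrite ger0_norm// (le_trans tK)// ltW.
have [phi incphi /cvg_ex[l tl]] := bolzano_weierstrass bt.
have phi_ge k : (k <= phi k)%N.
  elim: k => // k IH; apply: (leq_ltn_trans IH).
  by rewrite ltnNge; have := incphi k.+1 k; rewrite !leEnat => ->; rewrite -ltnNge.
have ft : f (fun=> t (phi k)) @[k --> \oo] --> f (fun=> l).
  apply: (@cvg_comp _ _ _ (fun k => (fun=> t (phi k)) : {ptws nat -> R}) f).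
    by apply: (@cvg_ptws _ _ _ (fun k => fun=> t (phi k)) (fun=> l)) => i; exact: tl.
  exact: cf.
(* The counterexamples converge to the constant sequence [l] coordinate by coordinate: coordinate i
   is constrained as soon as k > i. *)
have fy : f (y (phi k)) @[k --> \oo] --> f (fun=> l).
  apply: (@cvg_comp _ _ _ (fun k => y (phi k)) f); last exact: cf.
  apply: (@cvg_ptws _ _ _ (fun k => y (phi k)) (fun=> l)) => i.
  have diff : y (phi k) i - t (phi k) @[k --> \oo] --> (0 : R).
    apply/norm_cvg0P; apply: (@squeeze_cvgr _ _ _ _ (fun=> 0) harmonic).
    - near=> k; rewrite normr_ge0/=.
      have ik : (i < k)%N by near: k; exact: nbhs_infty_gt.
      have [_ yt _] := tyP (phi k).
      apply: le_trans (yt i _) _; first exact: leq_trans (phi_ge k).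
      by rewrite lef_pV2 ?posrE// ler_nat ltnS phi_ge.
    - exact: cvg_cst.
    - exact: cvg_harmonic.
  have -> : (fun k => y (phi k) i) =
      (fun k => (y (phi k) i - t (phi k)) + t (phi k)).
    by apply/funext => k; rewrite subrK.
  by rewrite -[X in _ --> X]add0r; exact: cvgD diff tl.
have : `|f (y (phi k)) - f (fun=> t (phi k))| @[k --> \oo] --> (0 : R).
  by apply/norm_cvg0P; rewrite -(subrr (f (fun=> l))); exact: cvgB.
move=> /(cvgr_to_ge (b := e)) H; have : e <= 0.
  by apply: H; apply: nearW => k; have [_ _ /ltW] := tyP (phi k).
by rewrite leNgt e0.
Unshelve. all: by end_near. Qed.

End sequence_space.

Section laplace_continuity.
Context (R : realType).
Context (d : nat -> measure_display) (T : forall n, measurableType (d n)).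
Context (P : forall n, probability (T n) R).
Context d' (T' : measurableType d') (P' : probability T' R).

Lemma cvg_integral_of_moments (u : forall n, T n -> R) (u' : T' -> R) (h : R -> R) (M : R) :
  (forall n, measurable_fun [set: T n] (u n)) -> measurable_fun [set: T'] u' ->
  (forall n w, 0 <= u n w <= 1) -> (forall w, 0 <= u' w <= 1) ->
  (forall k : nat, \int[P n]_w (u n w ^+ k) @[n --> \oo] --> \int[P']_w (u' w ^+ k)) ->
  measurable_fun [set: R] h -> (forall x, `|h x| <= M) ->
  (forall e, 0 < e -> exists p : {poly R}, forall x, 0 <= x <= 1 -> `|h x - p.[x]| <= e) ->
  \int[P n]_w h (u n w) @[n --> \oo] --> \int[P']_w h (u' w).
Proof.
move=> mu mu' u01 u'01 moments mh hM approx.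
have bnd k x : 0 <= x <= 1 -> `|x ^+ k| <= 1 :> R.
  by move=> /andP[x0 x1]; rewrite ger0_norm ?exprn_ge0// exprn_ile1.
have iX n k : (P n).-integrable [set: T n] (EFin \o (fun w => u n w ^+ k)).
  apply: (@bounded_integrable _ _ _ _ _ 1); first exact: measurable_funX.
  by move=> w; exact: bnd.
have iX' k : P'.-integrable [set: T'] (EFin \o (fun w => u' w ^+ k)).
  apply: (@bounded_integrable _ _ _ _ _ 1); first exact: measurable_funX.
  by move=> w; exact: bnd.
(* The factor [u ^+ k] generalizes the induction: peeling [p * 'X + c] turns [k] into [k.+1]. *)
have polyP (p : {poly R}) k :
   [/\ forall n, (P n).-integrable [set: T n] (EFin \o (fun w => p.[u n w] * u n w ^+ k)),
     P'.-integrable [set: T'] (EFin \o (fun w => p.[u' w] * u' w ^+ k)) &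
     \int[P n]_w (p.[u n w] * u n w ^+ k) @[n --> \oo] --> \int[P']_w (p.[u' w] * u' w ^+ k)].
  elim/poly_ind: p k => [|p c IH] k.
    have H (d1 : measure_display) (T1 : measurableType d1) (P1 : probability T1 R) (v : T1 -> R) :
        P1.-integrable [set: T1] (EFin \o (fun w => 0.[v w] * v w ^+ k)) /\
        \int[P1]_w (0.[v w] * v w ^+ k) = 0.
      have -> : (fun w => 0.[v w] * v w ^+ k) = (fun=> 0).
        by apply/funext => w; rewrite horner0 mul0r.
      by split; [exact: finite_measure_integrable_cst|rewrite Rintegral_prob_cst].
    split.
    - by move=> n; have [] := H _ _ (P n) (u n).
    - by have [] := H _ _ P' u'.
    - have [_ ->] := H _ _ P' u'.
      rewrite (_ : (fun n => _) = (fun=> 0)); first exact: cvg_cst.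
      by apply/funext => n; have [] := H _ _ (P n) (u n).
  have [IHn IH' IHcvg] := IH k.+1.
  have H (d1 : measure_display) (T1 : measurableType d1) (P1 : probability T1 R) (v : T1 -> R) :
      P1.-integrable [set: T1] (EFin \o (fun w => p.[v w] * v w ^+ k.+1)) ->
      P1.-integrable [set: T1] (EFin \o (fun w => v w ^+ k)) ->
      P1.-integrable [set: T1] (EFin \o (fun w => (p * 'X + c%:P).[v w] * v w ^+ k)) /\
      \int[P1]_w ((p * 'X + c%:P).[v w] * v w ^+ k) =
      \int[P1]_w (p.[v w] * v w ^+ k.+1) + c * \int[P1]_w (v w ^+ k).
    move=> i1 i2.
    have -> : (fun w => (p * 'X + c%:P).[v w] * v w ^+ k) =
        (fun w => p.[v w] * v w ^+ k.+1 + c * v w ^+ k).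
      by apply/funext => w; rewrite !hornerE exprS; ring.
    have i3 : P1.-integrable [set: T1] (EFin \o (fun w => c * v w ^+ k)).
      exact: (integrableZl measurableT c i2).
    split; first exact: (integrableD measurableT i1 i3).
    by rewrite RintegralD// RintegralZl.
  split.
  - by move=> n; have [] := H _ _ (P n) (u n) (IHn n) (iX n k).
  - by have [] := H _ _ P' u' IH' (iX' k).
  - have [_ ->] := H _ _ P' u' IH' (iX' k).
    rewrite (_ : (fun n => _) = (fun n => \int[P n]_w (p.[u n w] * u n w ^+ k.+1)
        + c * \int[P n]_w (u n w ^+ k))).
      by apply: cvgD => //; apply: cvgM => //; exact: cvg_cst.
    by apply/funext => n; have [] := H _ _ (P n) (u n) (IHn n) (iX n k).
apply/cvgrPdist_le => e e0.
have e3 : 0 < e / 3 by rewrite divr_gt0.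
have [p hp] := approx _ e3.
have mul_expr0 (U : Type) (v : U -> R) : (fun w => p.[v w] * v w ^+ 0) = (fun w => p.[v w]).
  by apply/funext => w; rewrite expr0 mulr1.
have [pn p' pcvg0] := polyP p 0%N.
have pcvg : \int[P n]_w p.[u n w] @[n --> \oo] --> \int[P']_w p.[u' w].
  move: pcvg0; rewrite mul_expr0; apply: cvg_trans; apply: near_eq_cvg.
  by apply: nearW => n; rewrite mul_expr0.
have close (d1 : measure_display) (T1 : measurableType d1) (P1 : probability T1 R) (v : T1 -> R) :
   measurable_fun [set: T1] v -> (forall w, 0 <= v w <= 1) ->
   P1.-integrable [set: T1] (EFin \o (fun w => p.[v w] * v w ^+ 0)) ->
   `|\int[P1]_w h (v w) - \int[P1]_w p.[v w]| <= e / 3.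
  rewrite mul_expr0 => mv v01 ip; rewrite -[leRHS](Rintegral_prob_cst P1).
  apply: Rintegral_dist_le => //.
  - apply: (@bounded_integrable _ _ _ _ _ M) => //; exact: measurableT_comp.
  - exact: finite_measure_integrable_cst.
  - by move=> w; exact: hp.
near=> n.
have pn_close : `|\int[P']_w p.[u' w] - \int[P n]_w p.[u n w]| <= e / 3.
  by near: n; move/cvgrPdist_le : pcvg; exact.
have := close _ _ (P n) (u n) (mu n) (u01 n) (pn n).
have := close _ _ P' u' mu' u'01 p'.
move: pn_close; rewrite !ler_norml => /andP[? ?] /andP[? ?] /andP[? ?].
by apply/andP; split; lra.
Unshelve. all: by end_near. Qed.

End laplace_continuity.

Section exponential_limit.
Context (R : realType).

Lemma ln_dist_le (c a b : R) : 0 < c -> c <= a -> c <= b ->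
  `|ln a - ln b| <= `|a - b| / c.
Proof.
move=> c0; wlog : a b / b <= a => [wlg ca cb|ba ca cb].
  have [ba|/ltW ab] := leP b a; first exact: wlg.
  by rewrite distrC (distrC a); exact: wlg.
have b0 : 0 < b by exact: lt_le_trans cb.
have a0 : 0 < a by exact: lt_le_trans ca.
rewrite !ger0_norm ?subr_ge0 ?ler_ln ?posrE//.
rewrite -ln_div ?posrE//.
have -> : a / b = 1 + (a - b) / b by field; rewrite gt_eqF.
apply: (@le_trans _ _ ((a - b) / b)).
  apply: le_ln1Dx; apply: (@lt_le_trans _ _ 0); first by rewrite ltrN10.
  by rewrite divr_ge0// ?subr_ge0// ltW.
by rewrite ler_wpM2l ?subr_ge0// lef_pV2 ?posrE.
Qed.

Lemma max_dist_le (c a b : R) : `|Num.max a c - Num.max b c| <= `|a - b|.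
Proof.
rewrite ler_norml; have := ler_norm (a - b); have := ler_norm (b - a).
by rewrite (distrC b a); have [] := leP a c; have [] := leP b c => ? ? ? ?;
  apply/andP; split; lra.
Qed.

Context (d : nat -> measure_display) (T : forall n, measurableType (d n)).
Context (P : forall n, probability (T n) R).
Context d' (T' : measurableType d') (P' : probability T' R).

(* In the variable u = exp(-x) the half-line becomes [0, 1] and the Laplace
   transform at integers becomes the sequence of moments. *)
Lemma cvg_integral_of_mgf (X : forall n, T n -> R) (Z : T' -> R) (g : R -> R) (M : R) :
  (forall n, measurable_fun [set: T n] (X n)) -> measurable_fun [set: T'] Z ->
  (forall n w, 0 <= X n w) -> (forall w, 0 <= Z w) ->
  (forall theta, theta < 1 -> \int[P n]_w expR (theta * X n w) @[n --> \oo] -->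
    \int[P']_w expR (theta * Z w)) ->
  (\forall n \near \oo, (P n).-integrable [set: T n] (EFin \o (fun w => expR (2^-1 * X n w)))) ->
  P'.-integrable [set: T'] (EFin \o (fun w => expR (2^-1 * Z w))) ->
  measurable_fun [set: R] g -> (forall x, `|g x| <= M) ->
  (forall K e, 0 < e -> exists2 delta, 0 < delta &
    forall s t, 0 <= t <= K -> `|s - t| <= delta -> `|g s - g t| <= e) ->
  \int[P n]_w g (X n w) @[n --> \oo] --> \int[P']_w g (Z w).
Proof.
move=> mX mZ X0 Z0 mgf iX iZ mg gM gunif.
have M0 : 0 <= M by apply: le_trans (gM 0).
set L := \int[P']_w expR (2^-1 * Z w).
have L0 : 0 <= L by apply: Rintegral_ge0 => w _; exact: expR_ge0.
apply/cvgrPdist_le => e e0.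
(* Chosen so that e^(K/2) >= K/2 makes the tail at most [e / 3]; [L + 1] eventually bounds the
   moments at theta = 1/2. *)
pose K := 2 * (6 * M * (L + 1) / e).
have K0 : 0 <= K by rewrite mulr_ge0// divr_ge0 ?(ltW e0)// !mulr_ge0// addr_ge0.
have tailK : 2 * M * expR (- (2^-1 * K)) * (L + 1) <= e / 3.
  have e3 : 0 < e / 3 by rewrite divr_gt0.
  rewrite expRN mulrAC ler_pdivrMr ?expR_gt0// -ler_pdivrMl//.
  apply: le_trans (expR_ge1Dx _).
  have -> : (e / 3)^-1 * (2 * M * (L + 1)) = 2^-1 * K.
    by rewrite /K; field; rewrite gt_eqF.
  by rewrite lerDr.
(* The function - ln is not uniformly continuous near 0. Cutting its argument off below at e^(-K)
   makes it Lipschitz and alters [g] only beyond [K]. *)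
pose c := expR (- K); have c0 : 0 < c := expR_gt0 _.
pose clamp u := - ln (Num.max u c).
pose h u := g (clamp u).
have clamp01 u : u <= 1 -> 0 <= clamp u <= K.
  move=> u1; have mc : 0 < Num.max u c by rewrite lt_max c0 orbT.
  rewrite oppr_ge0 ln_le0 ?ge_max ?u1 -?expR0 ?ler_expR ?oppr_le0//=.
  by rewrite lerNl -[- K]expRK ler_ln ?posrE// le_max lexx orbT.
have clamp_exp x : 0 <= x <= K -> clamp (expR (- x)) = x.
  move=> /andP[x0 xK]; rewrite /clamp max_l ?ler_expR ?lerN2//.
  by rewrite expRK opprK.
have mclamp : measurable_fun [set: R] clamp.
  apply: measurableT_comp => //; apply: measurableT_comp; first exact: measurable_ln.
  by apply: measurable_maxr.
have mh : measurable_fun [set: R] h by exact: measurableT_comp.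
have hM x : `|h x| <= M by exact: gM.
have happrox := weierstrass_approximation hM.
(* The cutoff error beyond [K] is at most 2 M, and e^((x - K)/2) >= 1 there; this reduces it to the
   moment at 1/2. *)
have hg x : 0 <= x -> `|g x - h (expR (- x))| <= 2 * M * expR (- (2^-1 * K)) * expR (2^-1 * x).
  move=> x0; have [xK|Kx] := leP x K.
    by rewrite /h clamp_exp ?x0// subrr normr0 !mulr_ge0 ?expR_ge0.
  rewrite (@le_trans _ _ (2 * M))//.
    by rewrite (le_trans (ler_normB _ _))//; have := gM x; have := hM (expR (- x)); lra.
  rewrite -mulrA -expRD ler_peMr ?mulr_ge0//.
  by apply: le_trans (expR_ge1Dx _); lra.
have mexp (d1 : measure_display) (T1 : measurableType d1) (Y : T1 -> R) (a : R) :
    measurable_fun [set: T1] Y -> measurable_fun [set: T1] (fun w => expR (a * Y w)).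
  by move=> mY; apply: measurableT_comp => //; exact: measurable_funM.
have Eexp x : expR (- x) = expR (-1 * x) by rewrite mulN1r.
have exp01 x : 0 <= x -> 0 <= expR (-1 * x) <= 1.
  by move=> x0; rewrite expR_ge0/= expR_le1 mulN1r oppr_le0.
have hcvg : \int[P n]_w h (expR (-1 * X n w)) @[n --> \oo] -->
    \int[P']_w h (expR (-1 * Z w)).
  apply: (@cvg_integral_of_moments R d T P d' T' P'
    (fun n w => expR (-1 * X n w)) (fun w => expR (-1 * Z w)) h M) => //.
  - by move=> n; exact: mexp.
  - exact: mexp.
  - by move=> n w; exact: exp01.
  - by move=> w; exact: exp01.
  - move=> k; have := @mgf (- k%:R) _.
    have -> : (fun n => \int[P n]_w (expR (-1 * X n w) ^+ k)) =
        (fun n => \int[P n]_w expR (- k%:R * X n w)).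
      apply/funext => n; apply: eq_Rintegral => w _.
      by rewrite -expRM_natl; congr expR; ring.
    have -> : \int[P']_w (expR (-1 * Z w) ^+ k) = \int[P']_w expR (- k%:R * Z w).
      apply: eq_Rintegral => w _.
      by rewrite -expRM_natl; congr expR; ring.
    by apply; rewrite (@le_lt_trans _ _ 0)// oppr_le0.
  - apply: happrox => e1 e10; have [dl dl0 gdl] := gunif K _ e10.
    exists (c * dl) => [|u v u01 v01 uv]; first by rewrite mulr_gt0.
    have /andP[_ u1] := u01; apply: gdl; first exact: clamp01.
    rewrite /clamp opprK addrC.
    apply: le_trans (ln_dist_le c0 _ _) _.
    + by rewrite le_max lexx orbT.
    + by rewrite le_max lexx orbT.
    rewrite ler_pdivrMr// mulrC; apply: le_trans uv.
    rewrite distrC; exact: max_dist_le.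
have close (d1 : measure_display) (T1 : measurableType d1) (P1 : probability T1 R) (Y : T1 -> R) :
    measurable_fun [set: T1] Y -> (forall w, 0 <= Y w) ->
    P1.-integrable [set: T1] (EFin \o (fun w => expR (2^-1 * Y w))) ->
    `|\int[P1]_w g (Y w) - \int[P1]_w h (expR (-1 * Y w))| <=
    2 * M * expR (- (2^-1 * K)) * \int[P1]_w expR (2^-1 * Y w).
  move=> mY Y0 iY; rewrite -RintegralZl//; apply: Rintegral_dist_le => //.
  - apply: (@bounded_integrable _ _ _ _ _ M) => [|w]; last exact: gM.
    exact: measurableT_comp.
  - apply: (@bounded_integrable _ _ _ _ _ M) => [|w]; last exact: hM.
    by apply: (measurableT_comp mh); exact: mexp.
  - exact: (integrableZl measurableT _ iY).
  - by move=> w; rewrite -Eexp; exact: hg.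
have A0 : 0 <= 2 * M * expR (- (2^-1 * K)) by rewrite !mulr_ge0 ?expR_ge0.
near=> n.
have Xn : \int[P n]_w expR (2^-1 * X n w) <= L + 1.
  near: n; apply: (cvgr_le L); last by rewrite ltrDl.
  by apply: mgf; rewrite invf_lt1// ltr1n.
have iXn : (P n).-integrable [set: T n] (EFin \o (fun w => expR (2^-1 * X n w))).
  by near: n.
have h1 := close _ _ (P n) (X n) (mX n) (X0 n) iXn.
have h2 := close _ _ P' Z mZ Z0 iZ.
have {}h1 : `|\int[P n]_w g (X n w) - \int[P n]_w h (expR (-1 * X n w))| <= e / 3.
  by apply: le_trans h1 _; apply: le_trans tailK; rewrite ler_wpM2l.
have {}h2 : `|\int[P']_w g (Z w) - \int[P']_w h (expR (-1 * Z w))| <= e / 3.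
  by apply: le_trans h2 _; apply: le_trans tailK; rewrite ler_wpM2l// lerDl.
have h3 : `|\int[P']_w h (expR (-1 * Z w)) - \int[P n]_w h (expR (-1 * X n w))| <= e / 3.
  by near: n; move/cvgrPdist_le : hcvg; apply; rewrite divr_gt0.
move: h1 h2 h3; rewrite !ler_norml => /andP[? ?] /andP[? ?] /andP[? ?].
by apply/andP; split; lra.
Unshelve. all: by end_near. Qed.

End exponential_limit.

(** * Integrals against the exponential law *)

Section exponential_law.
Context (R : realType) d (T : measurableType d) (P : probability T R).
Variable Y : {RV P >-> R}.
Hypothesis Y_exp : forall A : set R, measurable A ->
  distribution P Y A = exponential_prob 1 A.

Notation mu := (@lebesgue_measure R).

Let mpdf : measurable_fun [set: R] (fun x => (exponential_pdf 1 x)%:E).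
Proof. by apply/measurable_EFinP; exact: measurable_exponential_pdf. Qed.

(* Lebesgue measure lives on measurableTypeR R, which has the same measurable
   sets as R but another display. *)
Let YR : T -> measurableTypeR R := Y.

Let mYR : measurable_fun [set: T] YR.
Proof. exact: (@measurable_funPT _ _ _ _ Y). Qed.

#[local] HB.instance Definition _ := isMeasurableFun.Build _ _ _ _ YR mYR.

Let law : probability (measurableTypeR R) R :=
  distribution P (YR : {RV P >-> measurableTypeR R}).

Let lawE (A : set (measurableTypeR R)) : measurable A ->
  law A = (\int[mu]_(x in A) (exponential_pdf 1 x)%:E)%E.
Proof. exact: Y_exp. Qed.

Let law_dominates : law `<< mu.
Proof.
apply/null_content_dominatesP => A mA muA.
by rewrite lawE//; exact: (null_set_integral mA (measurable_funTS mpdf) muA).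
Qed.

(** The law is known only on measurable sets. Uniqueness of densities identifies its Radon-Nikodym
    derivative with the exponential density almost everywhere. *)
Lemma ge0_integral_exponential_law (f : R -> R) : measurable_fun [set: R] f ->
  (forall x, 0 <= f x) ->
  (\int[P]_w (f (Y w))%:E = \int[mu]_x (f x * exponential_pdf 1 x)%:E)%E.
Proof.
move=> mf f0.
have mfE : measurable_fun [set: measurableTypeR R] (fun x => (f x)%:E).
  exact/measurable_EFinP.
have f0E x : (0 <= (f x)%:E)%E by rewrite lee_fin.
have iRN := Radon_Nikodym_SigmaFinite.f_integrable law_dominates.
have mRN := measurable_int _ iRN.
transitivity (\int[law]_x (f x)%:E)%E.
  by rewrite (ge0_integral_distribution (YR : {RV P >-> measurableTypeR R}) mfE f0E).
rewrite -(Radon_Nikodym_SigmaFinite.change_of_variables law_dominates)//.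
apply: ae_eq_integral => //.
- exact: emeasurable_funM.
- apply: (eq_measurable_fun (fun x => ((f x)%:E * (exponential_pdf 1 x)%:E)%E)) => //.
  exact: emeasurable_funM.
have : ae_eq mu [set: measurableTypeR R] (Radon_Nikodym_SigmaFinite.f law mu)
    (fun x => (exponential_pdf 1 x)%:E).
  apply: (integral_ae_eq _ iRN mpdf) => // A _ mA.
  transitivity (law A); last exact: lawE.
  by rewrite (Radon_Nikodym_SigmaFinite.f_integral law_dominates).
by apply: filterS => x /= /[apply] ->.
Qed.

Lemma exponential_mgf (theta : R) : theta < 1 ->
  (\int[P]_w (expR (theta * Y w))%:E = ((1 - theta)^-1)%:E)%E.
Proof.
move=> theta1; have t1 : 0 < 1 - theta by rewrite subr_gt0.
rewrite (ge0_integral_exponential_law (f := fun x => expR (theta * x))) => [||x].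
(* Exponential tilting: e^(theta x) times the density of rate 1 is a multiple of the density of rate
   1 - theta, which has mass 1. *)
- rewrite (eq_integral (fun x : measurableTypeR R =>
    ((1 - theta)^-1%:E * (exponential_pdf (1 - theta) x)%:E)%E)); last first.
    move=> x _; rewrite -EFinM; congr EFin.
    have [x0|x0] := leP 0 x.
      rewrite !exponential_pdfE// mul1r -expRD mulrA mulVf ?gt_eqF// mul1r.
      by congr expR; ring.
    by rewrite !lt0_exponential_pdf// !mulr0.
  rewrite ge0_integralZl//.
  + by rewrite integral_exponential_pdf// mule1.
  + by apply/measurable_EFinP; exact: measurable_exponential_pdf.
  + by move=> x _; rewrite lee_fin exponential_pdf_ge0// ltW.
  + by rewrite lee_fin invr_ge0 ltW.
- by apply: measurableT_comp => //; exact: measurable_funM.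
- exact: expR_ge0.
Qed.

(** [Y] may be negative on a null set, whereas [cvg_integral_of_mgf] asks for nonnegativity
    everywhere; the positive part has the same integrals. *)
Lemma ge0_integral_exponential_pos (f : R -> R) : measurable_fun [set: R] f ->
  (forall x, 0 <= f x) ->
  (\int[P]_w (f (Num.max (Y w) 0))%:E = \int[P]_w (f (Y w))%:E)%E.
Proof.
move=> mf f0.
rewrite (ge0_integral_exponential_law mf f0).
rewrite (ge0_integral_exponential_law (f := fun x => f (Num.max x 0))) => [||x//].
  apply: eq_integral => x _; have [x0|x0] := leP 0 x; first by [].
  by rewrite lt0_exponential_pdf// !mulr0.
by apply: measurableT_comp => //; exact: measurable_maxr.
Qed.

End exponential_law.

(** * Concentration of the queues around their mean *)

Section diagonal_concentration.
Context (R : realType) (n : nat).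
Hypothesis n_gt0 : (0 < n)%N.

Lemma excess_exp_le (x : jsq_state n) (i : 'I_n) :
  expR `|excess R x i| <= exp_excess 160 x + expR (queue_gap R x).
Proof.
have W0 : 0 <= exp_excess (160 : R) x := exp_excess_ge0 _ x.
have [ei|ei] := leP 0 (excess R x i).
  rewrite ger0_norm// (@le_trans _ _ (exp_excess 160 x)) ?lerDl ?expR_ge0//.
  rewrite /exp_excess (bigD1 i)//= (@le_trans _ _ (expR (160 * excess R x i)))//.
    by rewrite ler_expR; lra.
  by rewrite lerDl sumr_ge0// => j _; exact: expR_ge0.
rewrite ltr0_norm// (@le_trans _ _ (expR (queue_gap R x))) ?lerDr//.
by rewrite ler_expR lerNl; exact: excess_ge.
Qed.

(** One error term per case: all queues are near t <= K; or t > K; or some scaled queue is farther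
    than 1/(k+1) from t, so its excess is beyond that over [eta]. The last two are bounded as in the
    exponential Markov inequality. Since k <= n, the first k coordinates are genuine queues, not
    padding. *)
Lemma pad_dist_le (f : {ptws nat -> R} -> R) (M K e eta : R) (k : nat) (x : jsq_state n) :
  (forall s, `|f s| <= M) -> 0 < eta -> 0 <= e -> (k <= n)%N ->
  (forall t (y : {ptws nat -> R}), 0 <= t <= K ->
    (forall i, (i < k)%N -> `|y i - t| <= k.+1%:R^-1) ->
    `|f y - f (fun=> t)| <= e) ->
  `|f (pad (fun i => eta * (x i)%:R)) - f (fun=> eta * mean_queue R x)| <=
  e + 2 * M * expR (- (2^-1 * K)) * expR (2^-1 * (eta * mean_queue R x))
    + 2 * M * expR (- (k.+1%:R^-1 / eta)) * (exp_excess 160 x + expR (queue_gap R x)).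
Proof.
move=> fM eta0 e0 kn near_diag; set t := eta * _; set y := pad _.
have M0 : 0 <= M by apply: le_trans (fM (fun=> 0)).
have W0 : 0 <= exp_excess (160 : R) x := exp_excess_ge0 _ x.
have WG0 : 0 <= exp_excess 160 x + expR (queue_gap R x) by rewrite addr_ge0 ?expR_ge0.
have t0 : 0 <= t by rewrite mulr_ge0 ?(ltW eta0)// divr_ge0.
set A := 2 * M * expR (- (2^-1 * K)) * _; set B := 2 * M * _ * _.
have A0 : 0 <= A by rewrite !mulr_ge0// expR_ge0.
have B0 : 0 <= B by rewrite !mulr_ge0// expR_ge0.
have f2M : `|f y - f (fun=> t)| <= 2 * M.
  by rewrite (le_trans (ler_normB _ _))//; have := fM y; have := fM (fun=> t); lra.
have [tK|Kt] := leP t K; last first.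
  apply: le_trans f2M _; rewrite (@le_trans _ _ A)//; last by lra.
  rewrite /A -mulrA -expRD ler_peMr ?mulr_ge0//.
  by apply: le_trans (expR_ge1Dx _); lra.
have yE (i : 'I_n) : y i = eta * (x i)%:R by rewrite /y /pad valK.
have [allc|] := boolP [forall i : 'I_n, `|y i - t| <= k.+1%:R^-1].
  rewrite (@le_trans _ _ e)//; last by lra.
  apply: near_diag => [|i ik]; first by rewrite t0.
  by have /forallP/(_ (Ordinal (leq_trans ik kn))) := allc.
rewrite negb_forall => /existsP[i]; rewrite -ltNge yE => far.
apply: le_trans f2M _; rewrite (@le_trans _ _ B)//; last by lra.
rewrite /B -mulrA ler_peMr ?mulr_ge0// expRN mulrC ler_pdivlMr ?expR_gt0// mul1r.
apply: le_trans (excess_exp_le x i); rewrite ler_expR ler_pdivrMr// ltW//.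
by move: far; rewrite /t -mulrBr normrM (gtr0_norm eta0) mulrC.
Qed.

End diagonal_concentration.

(** * Passage to the limit along the JSQ systems *)

Section heavy_traffic.
Context (R : realType) (mu alpha : R) (lambda : nat -> R).
Hypothesis mu_gt0 : 0 < mu.
Hypothesis alpha_gt1 : 1 < alpha.
Hypothesis lambdaE : forall n : nat, (0 < n)%N ->
  lambda n = n%:R * mu * (1 - n%:R `^ (- alpha)).
Context (Pt : forall n : nat, R -> jsq_state n -> jsq_state n -> R).
Hypothesis Pt_ctmc : forall n : nat, (0 < n)%N ->
  ctmc_transition (jsq_generator (lambda n) mu) (@Pt n).
Context (d : nat -> measure_display) (T : forall n : nat, measurableType (d n)).
Context (P : forall n : nat, probability (T n) R).
Context (q : forall n : nat, 'I_n -> {RV (P n) >-> nat}).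
Hypothesis q_stat : forall n : nat, (0 < n)%N ->
  stationary_distribution (@Pt n) (joint_law (@q n)).

Let eps n : R := n%:R `^ (- alpha).

Definition queues n (w : T n) : jsq_state n := [ffun i => @q n i w].

Lemma queuesE n (x : jsq_state n) : [set w : T n | queues w = x] = [set w | forall i, @q n i w = x i].
Proof.
apply/seteqP; split=> w /=; first by move=> <- i; rewrite ffunE.
by move=> qx; apply/ffunP => i; rewrite ffunE.
Qed.

Lemma measurable_queues n (x : jsq_state n) : measurable [set w : T n | queues w = x].
Proof.
rewrite queuesE (_ : [set w | _] = \bigcap_(i in [set: 'I_n]) (@q n i @^-1` [set x i])).
  apply: fin_bigcap_measurable => // i _.
  by rewrite -[X in measurable X]setTI; exact: (measurable_funPT (@q n i)).
by apply/seteqP; split=> w /= qx i; [move=> _; exact: qx|exact: qx].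
Qed.

Lemma queues_stationary n : (0 < n)%N ->
  stationary_distribution (@Pt n) (fun x => P n [set w | queues w = x]).
Proof.
move=> n0; suff -> : (fun x => P n [set w | queues w = x]) = joint_law (@q n) by exact: q_stat.
by apply/funext => x; rewrite queuesE.
Qed.

Lemma total_queues n (w : T n) : (total (queues w))%:R = \sum_(i < n) (@q n i w)%:R :> R.
Proof. by rewrite /total natr_sum; apply: eq_bigr => i _; rewrite ffunE. Qed.

Let alpha_gt0 : 0 < alpha. Proof. exact: lt_trans alpha_gt1. Qed.

Let n_epsE n : (0 < n)%N -> n%:R * eps n = n%:R `^ (1 - alpha).
Proof.
move=> n0; have nR : n%:R != 0 :> R by rewrite pnatr_eq0 -lt0n.
by rewrite powRD ?nR ?implybT// powRr1.
Qed.

Let cvg_n_eps : n%:R * eps n @[n --> \oo] --> (0 : R).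
Proof.
have := @cvg_powRN R (alpha - 1); rewrite subr_gt0 => /(_ alpha_gt1).
rewrite opprB; apply: cvg_trans; apply: near_eq_cvg; near=> n.
by rewrite n_epsE//; near: n; exact: nbhs_infty_gt.
Unshelve. all: by end_near. Qed.

Let regime n : Prop := [/\ (1 < n)%N, 0 < eps n, eps n <= 2^-1,
  n%:R * eps n <= 1 &
  n%:R * (expR (160 / n%:R) + expR (- 160 / n%:R) - 2) + eps n * 160
    - (1 - expR (- 160)) <= - 4^-1].

Let near_regime : \forall n \near \oo, regime n.
Proof.
near=> n; split.
- by near: n; exact: nbhs_infty_gt.
- by rewrite powR_gt0// ltr0n; near: n; exact: nbhs_infty_gt.
- near: n; apply: (cvgr_le _ (cvg_powRN alpha_gt0)).
  by rewrite invr_gt0.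
- by near: n; apply: (cvgr_le _ cvg_n_eps).
- by near: n; exact: near_excess_decay.
Unshelve. all: by end_near. Qed.

Let subcritical n theta : 0 < eps n -> theta < 1 -> (1 - eps n) * expR (theta * eps n) < 1.
Proof.
move=> e0 theta1; apply: (@le_lt_trans _ _ (expR (- eps n) * expR (theta * eps n))).
  by rewrite ler_wpM2r ?expR_ge0// expR_ge1Dx.
rewrite -expRD expR_lt1.
have -> : - eps n + theta * eps n = - ((1 - theta) * eps n) by ring.
by rewrite oppr_lt0 mulr_gt0// subr_gt0.
Qed.

Let near_small theta (b : R) : 0 < b -> \forall n \near \oo, `|theta * eps n| * n%:R <= b.
Proof.
move=> b0.
have c : `|theta| * (n%:R * eps n) @[n --> \oo] --> (0 : R).
  by rewrite -[X in _ --> X](mulr0 `|theta|); apply: cvgM => //; exact: cvg_cst.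
near=> n.
rewrite normrM (ger0_norm (powR_ge0 _ _)) -mulrA (mulrC _ n%:R).
by near: n; exact: (cvgr_le _ c).
Unshelve. all: by end_near. Qed.

Let mgf theta : theta < 1 ->
  (\forall n \near \oo, (P n).-integrable [set: T n]
     (EFin \o (fun w => expR (theta * eps n * (total (queues w))%:R)))) /\
  \int[P n]_w expR (theta * eps n * (total (queues w))%:R) @[n --> \oo]
     --> (1 - theta)^-1.
Proof.
move=> theta1; split.
  near=> n.
  have [n1 e0 e2 ne1 dec] : regime n by near: n; exact: near_regime.
  have n0 := ltnW n1.
  apply: (integrable_exp_total n1 mu_gt0 e0 e2 (lambdaE n0) dec (Pt_ctmc n0)
    (@measurable_queues n) (queues_stationary n0)); first exact: subcritical.
  by near: n; exact: near_small.
apply: (@cvg_mgf_of_bound R alpha theta (gap_bound R)) => //.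
near=> n.
have [n1 e0 e2 ne1 dec] : regime n by near: n; exact: near_regime.
have n0 := ltnW n1.
move=> K K0.
apply: (exp_total_moment n1 mu_gt0 e0 e2 ne1 (lambdaE n0) dec (Pt_ctmc n0)
    (@measurable_queues n) (queues_stationary n0)) => //; first exact: subcritical.
by near: n; apply: near_small; rewrite invr_gt0.
Unshelve. all: by end_near. Qed.

Lemma jsq_mgf_cvg theta : theta < 1 ->
  ('E_(P n)[fun w => expR (theta * n%:R `^ (- alpha) * \sum_(i < n) (@q n i w)%:R)]
     @[n --> \oo] --> ((1 - theta)^-1)%:E)%E.
Proof.
move=> theta1; have [int_mgf cvg_mgf] := mgf theta1.
have : (\int[P n]_w expR (theta * eps n * (total (queues w))%:R))%:E
    @[n --> \oo] --> ((1 - theta)^-1)%:E.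
  by apply: cvg_EFin; [exact: nearW|exact: cvg_mgf].
apply: cvg_trans; apply: near_eq_cvg; near=> n.
have intn : (P n).-integrable [set: T n]
    (EFin \o (fun w => expR (theta * eps n * (total (queues w))%:R))).
  by near: n; exact: int_mgf.
rewrite unlock /Rintegral fineK; last exact: integrable_fin_num.
by apply: eq_integral => w _; rewrite total_queues.
Unshelve. all: by end_near. Qed.

Section diagonal.
Variables (f : {ptws nat -> R} -> R) (M : R).
Hypothesis f_cont : continuous f.
Hypothesis f_bounded : forall s, `|f s| <= M.

Let eta n : R := n%:R `^ (1 - alpha).

Let scaled n (x : jsq_state n) : R := f (pad (fun i => eta n * (x i)%:R)).

Let X n (w : T n) : R := eps n * (total (queues w))%:R.

Let mqueues n (F : jsq_state n -> R) :
  measurable_fun [set: T n] (fun w => F (queues w)).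
Proof. exact: (measurable_countable_comp (@measurable_queues n)). Qed.

Let int_scaled n : (P n).-integrable [set: T n] (EFin \o (fun w => scaled (queues w))).
Proof.
by apply: (@bounded_integrable _ _ _ _ _ M) => [|w]; [exact: mqueues|exact: f_bounded].
Qed.

Let int_diag n : (P n).-integrable [set: T n] (EFin \o (fun w => f (fun=> X w))).
Proof.
apply: (@bounded_integrable _ _ _ _ _ M) => [|w]; last exact: f_bounded.
exact: (mqueues (fun x => f (fun=> eps n * (total x)%:R))).
Qed.

Lemma jsq_diagonal_cvg :
  \int[P n]_w f (pad (fun i => n%:R `^ (1 - alpha) * (@q n i w)%:R))
    - \int[P n]_w f (fun=> eps n * (total (queues w))%:R) @[n --> \oo] --> (0 : R).
Proof.
have M0 : 0 <= M by apply: le_trans (f_bounded (fun=> 0)).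
apply/cvgrPdist_le => e e0.
(* 18 is 2 * 3 * 3: the difference 2 M of values of [f], the eventual bound 3 on the moment at theta
   = 1/2, whose limit is 2, and the share [e / 3]. *)
pose K := 2 * (18 * M / e).
have K0 : 0 <= K by rewrite mulr_ge0// divr_ge0 ?(ltW e0)// mulr_ge0.
have tailK : 2 * M * expR (- (2^-1 * K)) * 3 <= e / 3.
  have e3 : 0 < e / 3 by rewrite divr_gt0.
  rewrite expRN mulrAC ler_pdivrMr ?expR_gt0// -ler_pdivrMl//.
  apply: le_trans (expR_ge1Dx _).
  have -> : (e / 3)^-1 * (2 * M * 3) = 2^-1 * K.
    by rewrite /K; field; rewrite gt_eqF.
  by rewrite lerDr.
have e3 : 0 < e / 3 by rewrite divr_gt0.
have [k near_diag] := continuous_near_diagonal K f_cont e3.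
pose delta : R := k.+1%:R^-1.
have delta0 : 0 < delta by rewrite invr_gt0.
pose D := 2 * M * (4 * expR 160 + gap_bound R).
(* The exponential sums over all queues have mean O(n); the factor exp(- delta n^(alpha - 1)) beats
   this n because alpha > 1. *)
have negligible : D * (n%:R `^ 1 * expR (- (delta * n%:R `^ (alpha - 1))))
    @[n --> \oo] --> (0 : R).
  rewrite -[X in _ --> X](mulr0 D); apply: cvgM; first exact: cvg_cst.
  by apply: cvg_powR_expRN => //; rewrite subr_gt0.
have half1 : 2^-1 < 1 :> R by rewrite invf_lt1// ltr1n.
have [int_half cvg_half] := mgf half1.
near=> n.
have [n1 e0' e2 ne1 dec] : regime n by near: n; exact: near_regime.
have n0 := ltnW n1.
have nR : 0 < n%:R :> R by rewrite ltr0n.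
have nR1 : 1 <= n%:R :> R by rewrite ler1n.
have [intW leW] := exp_excess_moment n1 mu_gt0 e0' e2 (lambdaE n0) dec (Pt_ctmc n0)
    (@measurable_queues n) (queues_stationary n0).
have [intG leG] := exp_gap_moment n1 mu_gt0 e0' e2 (lambdaE n0) dec (Pt_ctmc n0)
    (@measurable_queues n) (queues_stationary n0).
have intH : (P n).-integrable [set: T n]
    (EFin \o (fun w => expR (2^-1 * eps n * (total (queues w))%:R))).
  by near: n; exact: int_half.
have leH : \int[P n]_w expR (2^-1 * eps n * (total (queues w))%:R) <= 3.
  near: n; apply: (cvgr_le _ cvg_half).
  have -> : (1 - 2^-1)^-1 = 2 :> R by field.
  by rewrite ltr_nat.
have eta0 : 0 < eta n by rewrite powR_gt0.
have meanE (x : jsq_state n) : eta n * mean_queue R x = eps n * (total x)%:R.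
  by rewrite /eta -n_epsE// /mean_queue; field; rewrite gt_eqF.
pose A := 2 * M * expR (- (2^-1 * K)).
pose B := 2 * M * expR (- (delta / eta n)).
have A0 : 0 <= A by rewrite !mulr_ge0// expR_ge0.
have B0 : 0 <= B by rewrite !mulr_ge0// expR_ge0.
have intWG : (P n).-integrable [set: T n] (EFin \o
    (fun w => exp_excess 160 (queues w) + expR (queue_gap R (queues w)))).
  exact: (integrableD measurableT intW intG).
have intA : (P n).-integrable [set: T n] (EFin \o
    (fun w => A * expR (2^-1 * eps n * (total (queues w))%:R))).
  exact: (integrableZl measurableT A intH).
have intB : (P n).-integrable [set: T n] (EFin \o
    (fun w => B * (exp_excess 160 (queues w) + expR (queue_gap R (queues w))))).
  exact: (integrableZl measurableT B intWG).
have inte : (P n).-integrable [set: T n] (EFin \o (fun=> e / 3)).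
  exact: finite_measure_integrable_cst.
have inteA : (P n).-integrable [set: T n] (EFin \o
    (fun w => e / 3 + A * expR (2^-1 * eps n * (total (queues w))%:R))).
  exact: (integrableD measurableT inte intA).
have int_bound : (P n).-integrable [set: T n] (EFin \o
    (fun w => e / 3 + A * expR (2^-1 * eps n * (total (queues w))%:R)
     + B * (exp_excess 160 (queues w) + expR (queue_gap R (queues w))))).
  exact: (integrableD measurableT inteA intB).
rewrite sub0r normrN.
have -> : \int[P n]_w f (pad (fun i => n%:R `^ (1 - alpha) * (@q n i w)%:R)) =
    \int[P n]_w scaled (queues w).
  apply: eq_Rintegral => w _; rewrite /scaled; congr (f (pad _)).
  by apply/funext => i; rewrite ffunE.
apply: (@le_trans _ _ (\int[P n]_w (e / 3
    + A * expR (2^-1 * eps n * (total (queues w))%:R)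
    + B * (exp_excess 160 (queues w) + expR (queue_gap R (queues w)))))).
  apply: Rintegral_dist_le => // w.
  have kn : (k <= n)%N by near: n; exact: nbhs_infty_ge.
  have := pad_dist_le n0 (queues w) f_bounded eta0 (ltW e3) kn near_diag.
  by rewrite meanE (mulrA 2^-1 (eps n)).
rewrite RintegralD// RintegralD// Rintegral_prob_cst !RintegralZl// RintegralD//.
have hA : A * \int[P n]_w expR (2^-1 * eps n * (total (queues w))%:R) <= e / 3.
  by apply: le_trans tailK; rewrite ler_wpM2l.
have hB : B * (\int[P n]_w exp_excess 160 (queues w)
    + \int[P n]_w expR (queue_gap R (queues w))) <= e / 3.
  apply: (@le_trans _ _ (D * (n%:R `^ 1 * expR (- (delta * n%:R `^ (alpha - 1)))))).
    have -> : n%:R `^ (alpha - 1) = (eta n)^-1.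
      by rewrite /eta -powRN opprB.
    have gap0 := gap_bound_ge0 R.
    rewrite powRr1// /D /B.
    have -> : 2 * M * (4 * expR 160 + gap_bound R) * (n%:R * expR (- (delta / eta n))) =
      2 * M * expR (- (delta / eta n)) * ((4 * expR 160 + gap_bound R) * n%:R) by ring.
    rewrite ler_wpM2l// mulrDl lerD//.
    by apply: le_trans leG _; rewrite ler_peMr.
  near: n; apply: (cvgr_le _ negligible).
  exact: e3.
lra.
Unshelve. all: by end_near. Qed.

End diagonal.

Lemma jsq_cvg_in_distribution d' (T' : measurableType d') (P' : probability T' R)
    (Upsilon : {RV P' >-> R}) :
  (forall A : set R, measurable A ->
    distribution P' Upsilon A = exponential_prob 1 A) ->
  cvg_in_distribution P
    (fun n w => pad (fun i : 'I_n => n%:R `^ (1 - alpha) * (@q n i w)%:R))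
    P' (fun w => (fun _ : nat => Upsilon w) : {ptws nat -> R}).
Proof.
move=> Upsilon_exp f f_cont [M f_bounded].
pose g t := f (fun=> t).
have gM t : `|g t| <= M by exact: f_bounded.
have mg : measurable_fun [set: R] g.
  by apply: continuous_measurable_fun; exact: continuous_diagonal.
have mU : measurable_fun [set: T'] Upsilon by exact: measurable_funPT.
pose Z w := Num.max (Upsilon w) 0.
have mZ : measurable_fun [set: T'] Z by exact: measurable_maxr.
have mexp theta : measurable_fun [set: R] (fun x => expR (theta * x)).
  by apply: measurableT_comp => //; exact: measurable_funM.
have mgfZ theta : theta < 1 ->
    (\int[P']_w (expR (theta * Z w))%:E = ((1 - theta)^-1)%:E)%E.
  move=> theta1; rewrite -(exponential_mgf Upsilon_exp theta1).
  by rewrite (ge0_integral_exponential_pos Upsilon_exp (f := fun x => expR (theta * x))).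
have half1 : 2^-1 < 1 :> R by rewrite invf_lt1// ltr1n.
have gX : \int[P n]_w g (eps n * (total (queues w))%:R) @[n --> \oo] -->
    \int[P']_w g (Z w).
  apply: (@cvg_integral_of_mgf R d T P d' T' P'
    (fun n w => eps n * (total (queues w))%:R) Z g M) => //.
  - move=> n; exact: (measurable_countable_comp (@measurable_queues n)
      (fun x => eps n * (total x)%:R)).
  - by move=> n w; rewrite mulr_ge0// powR_ge0.
  - by move=> w; rewrite /Z le_max lexx orbT.
  - move=> theta theta1; have [_] := mgf theta1.
    rewrite [X in _ -> _ --> X](_ : _ = (1 - theta)^-1).
      apply: cvg_trans; apply: near_eq_cvg.
      by apply: nearW => n; apply: eq_Rintegral => w _; rewrite mulrA.
    by rewrite /Rintegral mgfZ.
  - have [+ _] := mgf half1; apply: filterS => n.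
    by apply: eq_integrable => // w _ /=; rewrite mulrA.
  - apply/integrableP; split.
      by apply/measurable_EFinP; apply: (measurableT_comp (mexp 2^-1)).
    rewrite (eq_integral (fun w => (expR (2^-1 * Z w))%:E)) ?mgfZ ?ltry// => w _.
    by rewrite /= ger0_norm// expR_ge0.
  - move=> K e e0; have [k near_diag] := continuous_near_diagonal K f_cont e0.
    by exists k.+1%:R^-1 => // s t tK st; exact: near_diag.
have iG (Y : T' -> R) : measurable_fun [set: T'] Y ->
    P'.-integrable [set: T'] (EFin \o (fun w => g (Y w))).
  move=> mY; apply: (@bounded_integrable _ _ _ _ _ M) => [|w]; last exact: gM.
  exact: measurableT_comp.
have iM : P'.-integrable [set: T'] (EFin \o (fun=> M)).
  exact: finite_measure_integrable_cst.
(* Adding [M] makes [g] nonnegative, as the comparison of integrals of the positive part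
   requires. *)
have gZ : \int[P']_w g (Z w) = \int[P']_w g (Upsilon w).
  apply: (addIr M); rewrite -(Rintegral_prob_cst P' M) -!RintegralD//; last 2 first.
  - exact: iG.
  - exact: iG.
  congr fine; apply: (ge0_integral_exponential_pos Upsilon_exp (f := fun x => g x + M)).
    exact: measurable_funD.
  by move=> x; rewrite -lerBlDr sub0r; have := gM x; rewrite ler_norml => /andP[].
have : \int[P n]_w f (pad (fun i => n%:R `^ (1 - alpha) * (@q n i w)%:R))
    @[n --> \oo] --> \int[P']_w g (Upsilon w).
  set A := (fun n => \int[P n]_w _).
  have -> : A = (fun n => (A n - \int[P n]_w g (eps n * (total (queues w))%:R))
      + \int[P n]_w g (eps n * (total (queues w))%:R)).
    by apply/funext => n; rewrite subrK.
  rewrite -gZ -[X in _ --> X]add0r; apply: cvgD gX.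
  exact: jsq_diagonal_cvg.
move=> cvg_real.
have : (\int[P n]_w f (pad (fun i => n%:R `^ (1 - alpha) * (@q n i w)%:R)))%:E
    @[n --> \oo] --> (\int[P']_w g (Upsilon w))%:E.
  by apply: cvg_EFin; [exact: nearW|exact: cvg_real].
have -> : ('E_P'[f \o (fun w => (fun _ : nat => Upsilon w) : {ptws nat -> R})] =
    (\int[P']_w g (Upsilon w))%R%:E)%E.
  by rewrite unlock /Rintegral fineK//; exact: integrable_fin_num (iG _ mU).
apply: cvg_trans; apply: near_eq_cvg; apply: nearW => n.
rewrite unlock /Rintegral fineK//; apply: integrable_fin_num => //.
apply: (@bounded_integrable _ _ _ _ _ M) => [|w]; last exact: f_bounded.
rewrite (_ : (fun w => _) =
  (fun w => f (pad (fun i => n%:R `^ (1 - alpha) * (queues w i)%:R)))).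
  exact: (measurable_countable_comp (@measurable_queues n)
    (fun x : jsq_state n => f (pad (fun i => n%:R `^ (1 - alpha) * (x i)%:R)))).
apply/funext => w; congr (f (pad _)); apply/funext => i.
by rewrite ffunE.
Qed.

End heavy_traffic.

Unset Implicit Arguments.

Theorem theorem1 (R : realType) (mu alpha : R) (lambda : nat -> R)
  (hmu : 0 < mu) (halpha : 1 < alpha)
  (hlambda : forall n : nat, (0 < n)%N ->
     lambda n = n%:R * mu * (1 - n%:R `^ (- alpha)))
  (* transition function of the JSQ queue-length Markov chain *)
  (Pt : forall n : nat, R -> jsq_state n -> jsq_state n -> R)
  (hPt : forall n : nat, (0 < n)%N ->
     ctmc_transition (jsq_generator (lambda n) mu) (Pt n))
  (* steady-state queue lengths *)
  (d : nat -> measure_display) (T : forall n : nat, measurableType (d n))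
  (P : forall n : nat, probability (T n) R)
  (q : forall n : nat, 'I_n -> {RV (P n) >-> nat})
  (hq : forall n : nat, (0 < n)%N ->
     stationary_distribution (Pt n) (joint_law (q n)))
  (* an exponential random variable with mean 1 *)
  (d' : measure_display) (T' : measurableType d') (P' : probability T' R)
  (Upsilon : {RV P' >-> R})
  (hUpsilon : forall A : set R, measurable A ->
     distribution P' Upsilon A = exponential_prob 1 A) :
  (forall theta : R, theta < 1 ->
     ('E_(P n)[fun w => expR (theta * n%:R `^ (- alpha) *
                              \sum_(i < n) (q n i w)%:R)]
        @[n --> \oo] --> ((1 - theta)^-1)%:E)%E) /\
  cvg_in_distribution P
    (fun n w => pad (fun i : 'I_n => n%:R `^ (1 - alpha) * (q n i w)%:R))
    P' (fun w => (fun _ : nat => Upsilon w) : {ptws nat -> R}).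
Proof.
split=> [theta theta1|].
  exact: (jsq_mgf_cvg hmu halpha hlambda hPt hq theta1).
exact: (jsq_cvg_in_distribution hmu halpha hlambda hPt hq hUpsilon).
Qed.
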